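(* Let $\widetilde{\Sigma}$ be a 2-stack call-return alphabet and $\mathcal{L}\subseteq\mathbb{NW}^\omega(\widetilde{\Sigma})$ a set of infinite nested words. The following are equivalent: (1) there is a Büchi 2VPA $\mathcal{A}$ over $\widetilde{\Sigma}$ with $\mathcal{L}^\omega(\mathcal{A})=\mathcal{L}$; (2) there is a sentence $\phi\in\mathrm{EMSO}^\infty(\tau_{\widetilde{\Sigma}})$ with $\mathcal{L}^\omega(\phi)=\mathcal{L}$.
   Context: For $n\in\mathbb{N}$ let $[n]=\{1,\dots,n\}$, $\mathbb{N}_+=\{1,2,\dots\}$. A 2-stack call-return alphabet is $\widetilde{\Sigma}=\langle\{(\Sigma_c^1,\Sigma_r^1),(\Sigma_c^2,\Sigma_r^2)\},\Sigma_{int}\rangle$ of pairwise disjoint finite sets; $\Sigma_c=\Sigma_c^1\cup\Sigma_c^2$, $\Sigma_r=\Sigma_r^1\cup\Sigma_r^2$, $\Sigma=\Sigma_c\cup\Sigma_r\cup\Sigma_{int}$. A Büchi 2VPA over $\widetilde{\Sigma}$ is $\mathcal{A}=(Q,\Gamma,\delta,Q_I,F)$ with finite $Q$, $Q_I,F\subseteq Q$, finite $\Gamma\ni\bot$, $\delta=\langle\delta_c,\delta_r,\delta_{int}\rangle$, $\delta_c\subseteq Q\times\Sigma_c\times(\Gamma\setminus\{\bot\})\times Q$, $\delta_r\subseteq Q\times\Sigma_r\times\Gamma\times Q$, $\delta_{int}\subseteq Q\times\Sigma_{int}\times Q$. A run on $w=a_1a_2\dots\in\Sigma^\omega$ is an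 infinite sequence of configurations $(q_i,\sigma_i^1,\sigma_i^2)$, $i\ge0$, stack contents in $(\Gamma\setminus\{\bot\})^*\bot$, $q_0\in Q_I$, $\sigma_0^1=\sigma_0^2=\bot$, and for each $i\ge1$: a call $a_i\in\Sigma_c^s$ uses $(q_{i-1},a_i,A,q_i)\in\delta_c$ and pushes $A$ on stack $s$; a return $a_i\in\Sigma_r^s$ uses $(q_{i-1},a_i,A,q_i)\in\delta_r$ and either $A\ne\bot$ is popped from the top of stack $s$, or $A=\bot$ and stack $s$ is and stays $\bot$; an internal $a_i$ uses $(q_{i-1},a_i,q_i)\in\delta_{int}$; untouched stacks are unchanged. It is accepting if some state of $F$ occurs as $q_i$ for infinitely many $i$; $L^\omega(\mathcal{A})$ is the set of accepted infinite strings. A string is $s$-well formed if generated by $A::=aAb\mid AA\mid\varepsilon\mid c$ with $a\in\Sigma_c^s$, $b\in\Sigma_r^s$, $c\in\Sigma\setminus(\Sigma_c^s\cup\Sigma_r^s)$. An infinite nested word is $(\mathbb{N}_+,\lessdot,\mu,\lambda)$ with $\lessdot=\{(i,i+1)\mid i\in\mathbb{N}_+\}$, $\lambda:\mathbb{N}_+\to\Sigma$, $\mu=\mu^1\cup\mu^2$ with $(i,j)\in\mu^s$ iff $i<j$, $\lambda(i)\in\Sigma_c^s$, $\lambda(j)\in\Sigma_r^s$ and $\lambda(i+1)\dots\lambda(j-1)$ is $s$-well formed. $\mathbb{NW}^\omega(\widetilde{\Sigma})$ is the set of these; each $w\in\Sigma^\omega$ determines a unique infinite nested word $\mathrm{nested}(w)$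 with label sequence $w$, and $\mathcal{L}^\omega(\mathcal{A})=\{\mathrm{nested}(w)\mid w\in L^\omega(\mathcal{A})\}$. $\mathrm{MSO}^\infty(\tau_{\widetilde{\Sigma}})$ is given by $\phi::=\lambda(x)=a\mid x\lessdot y\mid\mu(x,y)\mid x=y\mid x\in X\mid\neg\phi\mid\phi\vee\phi\mid\exists x\phi\mid\exists^\infty x\phi\mid\exists X\phi$ ($a\in\Sigma$), interpreted over infinite nested words in the usual way, where $\exists^\infty y\,\phi$ holds iff $\phi$ holds for infinitely many values of $y$. $\mathrm{EMSO}^\infty(\tau_{\widetilde{\Sigma}})$ consists of formulas $\exists X_1\dots\exists X_n\,\psi$ with $\psi$ free of second-order quantifiers (but possibly using $\exists^\infty$). $\mathcal{L}^\omega(\phi)$ is the set of infinite nested words over $\widetilde{\Sigma}$ satisfying the sentence $\phi$. *)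

(* Defs.v *)
From mathcomp Require Import all_boot.
From mathcomp Require Import boolp classical_sets functions cardinality.

Set Implicit Arguments.
Unset Strict Implicit.
Unset Printing Implicit Defensive.

Local Open Scope classical_set_scope.

(* The partition of the letters into the five pairwise disjoint finite sets
   Sigma_c^s, Sigma_r^s (s : 'I_2) and Sigma_int is given by a classifying
   function; some of the five classes may be empty. *)
Variant kind := Call of 'I_2 | Ret of 'I_2 | Internal.

Record alphabet := Alphabet {
  letter :> finType;
  kind_of : letter -> kind
}.

Definition is_call (S : alphabet) (s : 'I_2) (a : S) : bool :=
  if kind_of a is Call t then t == s else false.

Definition is_ret (S : alphabet) (s : 'I_2) (a : S) : bool :=
  if kind_of a is Ret t then t == s else false.

Definition is_internal (S : alphabet) (a : S) : bool :=
  if kind_of a is Internal then true else false.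

(* Infinite words are functions on nat: index i stands for the position i.+1
   of the set {1, 2, ...} of positions, i.e. w i is the letter a_(i+1). *)
Definition word (S : alphabet) := nat -> S.

(** Automata *)

Record vpa (S : alphabet) := VPA {
  vstate : finType;
  vsym : finType;
  vbot : vsym;
  vcall : {set vstate * S * vsym * vstate};
  vret : {set vstate * S * vsym * vstate};
  vint : {set vstate * S * vstate};
  vinit : {set vstate};
  vfinal : {set vstate};
  vcall_sub : forall q a X q', (q, a, X, q') \in vcall ->
    [exists s, is_call s a] && (X != vbot);
  vret_sub : forall q a X q', (q, a, X, q') \in vret -> [exists s, is_ret s a];
  vint_sub : forall q a q', (q, a, q') \in vint -> is_internal a
}.

Section Runs.
Variables (S : alphabet) (A : vpa S).

(* Stack contents are listed from the top. *)
Record config := Config {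
  cstate : vstate A;
  cstack : 'I_2 -> seq (vsym A)
}.

Definition is_stack (u : seq (vsym A)) : Prop :=
  exists2 v, vbot A \notin v & u = rcons v (vbot A).

Definition same_stacks_but (s : 'I_2) (c c' : config) : Prop :=
  forall t, t != s -> cstack c' t = cstack c t.

Definition step (a : S) (c c' : config) : Prop :=
  match kind_of a with
  | Call s => exists X, [/\ (cstate c, a, X, cstate c') \in vcall A,
      cstack c' s = X :: cstack c s & same_stacks_but s c c']
  | Ret s => exists X, [/\ (cstate c, a, X, cstate c') \in vret A,
      (X <> vbot A /\ cstack c s = X :: cstack c' s) \/
      [/\ X = vbot A, cstack c s = [:: vbot A] & cstack c' s = [:: vbot A]] &
      same_stacks_but s c c']
  | Internal => (cstate c, a, cstate c') \in vint A /\
      forall t, cstack c' t = cstack c t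
  end.

Definition is_run (w : word S) (rho : nat -> config) : Prop :=
  [/\ forall i s, is_stack (cstack (rho i) s),
      cstate (rho 0) \in vinit A,
      forall s, cstack (rho 0) s = [:: vbot A] &
      forall i, step (w i) (rho i) (rho i.+1)].

Definition accepting (rho : nat -> config) : Prop :=
  exists2 f, f \in vfinal A & infinite_set [set i | cstate (rho i) = f].

Definition word_lang : set (word S) :=
  [set w | exists2 rho, is_run w rho & accepting rho].

End Runs.

(** Nested words *)

Inductive well_formed (S : alphabet) (s : 'I_2) : seq S -> Prop :=
| wf_match a u b : is_call s a -> well_formed s u -> is_ret s b ->
    well_formed s (a :: rcons u b)
| wf_cat u v : well_formed s u -> well_formed s v -> well_formed s (u ++ v)
| wf_nil : well_formed s [::]
| wf_other c : ~~ is_call s c -> ~~ is_ret s c -> well_formed s [:: c].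

(* The letters strictly between positions i and j. *)
Definition between (S : alphabet) (w : word S) (i j : nat) : seq S :=
  [seq w k | k <- iota i.+1 (j - i.+1)].

Definition nesting (S : alphabet) (w : word S) (s : 'I_2) : set (nat * nat) :=
  [set p | [/\ p.1 < p.2, is_call s (w p.1), is_ret s (w p.2)
             & well_formed s (between w p.1 p.2)]].

(* The successor relation is the same in all nested words and is therefore
   not a field. *)
Record nested_word (S : alphabet) := NestedWord {
  label : word S;
  mu : set (nat * nat);
  muE : mu = \bigcup_s nesting label s
}.

Definition nested (S : alphabet) (w : word S) : nested_word S :=
  @NestedWord S w _ erefl.

Lemma nested_label (S : alphabet) (v : nested_word S) : nested (label v) = v.
Proof. by case: v => w m e; subst m. Qed.

Definition vpa_lang (S : alphabet) (A : vpa S) : set (nested_word S) :=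
  @nested S @` word_lang A.

(** Logic *)

(* First-order and second-order variables are two separate copies of nat. *)
Inductive mso (S : alphabet) :=
| MLabel of nat & S
| MSucc of nat & nat
| MMu of nat & nat
| MEq of nat & nat
| MIn of nat & nat
| MNot of mso S
| MOr of mso S & mso S
| MEx of nat & mso S
| MExInf of nat & mso S
| MEx2 of nat & mso S.

Definition upd (T : Type) (e : nat -> T) (x : nat) (t : T) : nat -> T :=
  fun y => if y == x then t else e y.

Fixpoint sat (S : alphabet) (v : nested_word S)
    (e : nat -> nat) (E : nat -> set nat) (phi : mso S) : Prop :=
  match phi with
  | MLabel x a => label v (e x) = a
  | MSucc x y => e y = (e x).+1
  | MMu x y => mu v (e x, e y)
  | MEq x y => e x = e y
  | MIn x X => E X (e x)
  | MNot p => ~ sat v e E p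
  | MOr p q => sat v e E p \/ sat v e E q
  | MEx x p => exists i, sat v (upd e x i) E p
  | MExInf x p => infinite_set [set i | sat v (upd e x i) E p]
  | MEx2 X p => exists I, sat v e (upd E X I) p
  end.

Fixpoint free1 (S : alphabet) (phi : mso S) : seq nat :=
  match phi with
  | MLabel x _ | MIn x _ => [:: x]
  | MSucc x y | MMu x y | MEq x y => [:: x; y]
  | MNot p | MEx2 _ p => free1 p
  | MOr p q => free1 p ++ free1 q
  | MEx x p | MExInf x p => [seq y <- free1 p | y != x]
  end.

Fixpoint free2 (S : alphabet) (phi : mso S) : seq nat :=
  match phi with
  | MIn _ X => [:: X]
  | MLabel _ _ | MSucc _ _ | MMu _ _ | MEq _ _ => [::]
  | MNot p | MEx _ p | MExInf _ p => free2 p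
  | MOr p q => free2 p ++ free2 q
  | MEx2 X p => [seq Y <- free2 p | Y != X]
  end.

Definition sentence (S : alphabet) (phi : mso S) : bool :=
  (free1 phi == [::]) && (free2 phi == [::]).

Fixpoint no_set_quantifier (S : alphabet) (phi : mso S) : bool :=
  match phi with
  | MLabel _ _ | MSucc _ _ | MMu _ _ | MEq _ _ | MIn _ _ => true
  | MNot p | MEx _ p | MExInf _ p => no_set_quantifier p
  | MOr p q => no_set_quantifier p && no_set_quantifier q
  | MEx2 _ _ => false
  end.

Fixpoint is_emso (S : alphabet) (phi : mso S) : bool :=
  if phi is MEx2 _ p then is_emso p else no_set_quantifier phi.

(* For a sentence the choice of the assignments is irrelevant. *)
Definition mso_lang (S : alphabet) (phi : mso S) : set (nested_word S) :=
  [set v | forall e E, sat v e E phi].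

(* Main.v *)
(* A formula describes a run by guessing with its set variables the transition
   read at each position: the stacks are consistent iff matched positions use the
   same symbol.

   Conversely, successor and matching are given by three involutions of the
   positions. An Ehrenfeucht-Fraisse argument shows that the truth of a
   first-order sentence with the quantifier for infinity depends only on how often
   each type of ball of some radius occurs, up to a threshold, and on whether it
   occurs infinitely often. So it is enough that an automaton guesses the ball
   type of each position. What is found at the ends of short walks can be checked
   step by step; the difficulty is to decide which walks from a position have the
   same end. The automaton guesses a finite colouring that separates any two
   positions joined by a short walk, and this is what must be verified locally.

   Draw the matching of stack 0 above the line of positions and that of stack 1
   below it, which gives a plane graph. If a short walk returns to its colour, the
   automaton demands that it sees from the end the same as from the start, and
   that the walk, if it passes no other colour twice, has total turning +-1, as a
   simple closed curve does. If the walk is not closed, then it can be repeated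
   for ever, and either closes up to a simple curve after k > 1 rounds, whose
   total turning would be +-k, or runs through infinitely many positions. The
   latter is impossible as a simple path from its leftmost to its rightmost point
   has total turning 0, while the turnings of the rounds add up. Turning is
   counted below in half-turns, and computed by Hopf's rotating secants. *)
Require Import Defs.
From mathcomp Require Import all_boot.
From mathcomp Require Import boolp classical_sets functions cardinality.
From mathcomp Require Import ssralg ssrnum ssrint.
From mathcomp Require Import zify ring.

Set Implicit Arguments.
Unset Strict Implicit.
Unset Printing Implicit Defensive.
Import GRing.Theory.

(** * Pending calls and the matching relation *)

Definition infinitely_often (P : nat -> Prop) : Prop := forall n, exists2 m, n <= m & P m.

Lemma infinite_setP (P : nat -> Prop) :
  infinite_set [set i | P i]%classic <-> infinitely_often P.
Proof.
split=> [Pinf n | Pio].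
  apply: contrapT => Pn; apply: Pinf.
  apply: (@sub_finite_set _ _ (`I_n)%classic); last exact: finite_II.
  move=> i /= Pi; rewrite ltnNge; apply/negP => le_ni.
  by apply: Pn; exists i.
move=> /finite_seqP[s Ps].
have [m le_m Pm] := Pio (\max_(i <- s) i).+1.
have : m \in s by have : [set` s]%classic m by rewrite -Ps.
by move=> /(@leq_bigmax_seq _ _ predT id)/(_ isT) /=; rewrite leqNgt le_m.
Qed.

Lemma infinitely_often_pigeonhole (T : finType) (f : nat -> T) (P : nat -> Prop) :
  infinitely_often P -> exists x, infinitely_often (fun m => P m /\ f m = x).
Proof.
move=> Pio; apply: contrapT => noP.
have bound x : exists n, forall m, n <= m -> P m -> f m <> x.
  apply: contrapT => nb; apply: noP; exists x => n.
  apply: contrapT => nm; apply: nb; exists n => m le_nm Pm fm.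
  by apply: nm; exists m.
have /choice[b bP] := bound.
have [m le_m Pm] := Pio (\max_x b x).
by apply: (bP (f m) m) => //; apply: leq_trans le_m; apply: leq_bigmax.
Qed.

Section Pending.
Variables (S : alphabet) (w : word S).
Implicit Types (s : 'I_2) (i j k n : nat).

Lemma call_not_ret s (a : S) : is_call s a -> is_ret s a = false.
Proof. by rewrite /is_call /is_ret; case: kind_of. Qed.

(* The positions of the calls that stack [s] holds before position [n] is
   read, from the top. *)
Fixpoint pend s n : seq nat :=
  if n is k.+1 then
    if is_call s (w k) then k :: pend s k
    else if is_ret s (w k) then behead (pend s k) else pend s k
  else [::].

Lemma pend_call s n : is_call s (w n) -> pend s n.+1 = n :: pend s n.
Proof. by move=> /= ->. Qed.

Lemma pend_ret s n : is_ret s (w n) -> pend s n.+1 = behead (pend s n).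
Proof.
move=> rn /=; case: ifP => [/call_not_ret|_]; last by rewrite rn.
by rewrite rn.
Qed.

Lemma pend_other s n :
  ~~ is_call s (w n) -> ~~ is_ret s (w n) -> pend s n.+1 = pend s n.
Proof. by move=> /= /negbTE-> /negbTE->. Qed.

(** Induction on the grammar. In [wf_match] the letters inside restore the stack, so the last return
    pops exactly the call pushed by the first letter. *)
Lemma pend_well_formed s u : well_formed s u ->
  forall k, u = [seq w i | i <- iota k (size u)] -> pend s (k + size u) = pend s k.
Proof.
elim=> {u} [a u b ca _ IH rb|u v _ IHu _ IHv||c nc nr] k; last 2 first.
- by rewrite addn0.
- by case=> ec; rewrite addn1 pend_other // -ec.
- have -> : iota k (size (a :: rcons u b)) = k :: rcons (iota k.+1 (size u)) (k.+1 + size u).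
    by rewrite /= size_rcons -cats1 -[[:: _]]/(iota (k.+1 + size u) 1) -iotaD addn1.
  rewrite map_cons map_rcons => -[ea /rcons_inj[eu eb]].
  have rb' : is_ret s (w (k.+1 + size u)) by rewrite -eb.
  have -> : k + size (a :: rcons u b) = (k.+1 + size u).+1 by rewrite /= size_rcons; lia.
  by rewrite pend_ret // IH // pend_call // -ea.
- rewrite size_cat iotaD map_cat => /eqP; rewrite eqseq_cat ?size_map ?size_iota //.
  by move=> /andP[/eqP eu /eqP ev]; rewrite addnA IHv // IHu.
Qed.

Lemma between_cat i k j : i < k -> k < j ->
  between w i j = between w i k ++ w k :: between w k j.
Proof.
move=> ik kj; rewrite /between.
have -> : j - i.+1 = (k - i.+1) + (j - k.+1).+1 by lia.
by rewrite iotaD map_cat /= subnKC.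
Qed.

Lemma between_rcons i j : i < j -> between w i j.+1 = rcons (between w i j) (w j).
Proof.
move=> ij; rewrite /between.
have -> : j.+1 - i.+1 = (j - i.+1).+1 by lia.
by rewrite -[(j - i.+1).+1]addn1 iotaD map_cat cats1 subnKC.
Qed.

(** Strong induction on [j]. After a return the new top [i] lay directly under the popped call [k],
    so the hypothesis is used twice, for [k] and then, at [k], for [i]; the letters in between form
    a well-formed word followed by a matched block. *)
Lemma pend_head s j i l : pend s j = i :: l ->
  [/\ i < j, is_call s (w i), pend s i = l & well_formed s (between w i j)].
Proof.
elim/ltn_ind: j i l => -[//|j] IH i l.
have [cj|ncj] := boolP (is_call s (w j)).
  rewrite pend_call // => -[<- <-]; split => //.
  by rewrite /between subnn; constructor.
have [rj|nrj] := boolP (is_ret s (w j)); last first.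
  rewrite pend_other // => /(IH _ (ltnSn j))[ij ci pi wi]; split => //.
    exact: ltnW.
  by rewrite between_rcons // -cats1; constructor => //; constructor.
rewrite pend_ret //; case ej: (pend s j) => [//|k l'] /= el'; subst l'.
have [kj ck pk wk] := IH _ (ltnSn j) _ _ ej.
have [ik ci pi wi] := IH _ (leqW kj) _ _ pk.
split=> //; first lia.
rewrite between_rcons; last lia.
rewrite (between_cat ik kj) rcons_cat rcons_cons.
by constructor => //; constructor.
Qed.

(** This trades the grammar for the stack: functionality and non-crossing of the matching become
    properties of [pend]. *)
Lemma nestingP s i j :
  nesting w s (i, j) <-> is_ret s (w j) /\ exists l, pend s j = i :: l.
Proof.
split=> [[/= ij ci rj wf]|[rj [l /pend_head[ij ci pi wf]]]]; last by split.
split=> //; exists (pend s i).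
have sz : size (between w i j) = j - i.+1 by rewrite size_map size_iota.
have := pend_well_formed wf (k := i.+1); rewrite sz pend_call //.
by rewrite subnKC // => ->.
Qed.

Lemma nesting_kind s i j : nesting w s (i, j) -> is_call s (w i) /\ is_ret s (w j).
Proof. by case. Qed.

Lemma nesting_lt s i j : nesting w s (i, j) -> i < j.
Proof. by case. Qed.

Lemma nesting_fun_ret s i i' j :
  nesting w s (i, j) -> nesting w s (i', j) -> i = i'.
Proof. by move=> /nestingP[_ [l e]] /nestingP[_ [l']]; rewrite e => -[]. Qed.

Lemma pend_lt s n i : i \in pend s n -> i < n.
Proof.
elim: n => [//|n IH] /=; case: ifP => _.
  by rewrite inE => /orP[/eqP->//|/IH]; lia.
case: ifP => _; last by move=> /IH; lia.
by move=> /mem_behead/IH; lia.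
Qed.

(** A position enters its stack only at the moment it is read. *)
Lemma pend_persist s n m i : i < n -> n <= m -> i \in pend s m -> i \in pend s n.
Proof.
move=> lt_in /subnKC <-; elim: (m - n) => [|d IH]; first by rewrite addn0.
rewrite addnS /=; case: ifP => _.
  by rewrite inE => /orP[/eqP ei|/IH//]; lia.
by case: ifP => _ // /mem_behead.
Qed.

Lemma pend_sorted s n : sorted gtn (pend s n).
Proof.
elim: n => [//|n IH] /=; case: ifP => _.
  have : all (gtn n) (pend s n) by apply/allP => i /pend_lt.
  case: (pend s n) IH => [//|k l] /= -> /andP[-> _] //.
by case: ifP => _ //; case: (pend s n) IH => [//|k [//|k' l]] /= /andP[].
Qed.

Lemma pend_le_head s n i l k : pend s n = i :: l -> k \in pend s n -> k <= i.
Proof.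
have := pend_sorted s n => + e; rewrite e /=.
rewrite path_sortedE; last by move=> ? ? ?; rewrite /gtn /=; lia.
by move=> /andP[/allP h _]; rewrite inE => /orP[/eqP->//|/h /=]; lia.
Qed.

(** Otherwise [i'] would still be pending when [j] pops [i], although the top [i] is then the
    largest pending position. *)
Lemma nesting_noncrossing s i j i' j' :
  nesting w s (i, j) -> nesting w s (i', j') -> i < i' -> i' < j -> j' < j.
Proof.
move=> n1 n2 ii' i'j; rewrite ltnNge; apply/negP => jj'.
have [_ [l el]] := (nestingP _ _ _).1 n1.
have [_ [l' el']] := (nestingP _ _ _).1 n2.
have : i' \in pend s j by apply: (pend_persist i'j jj'); rewrite el' mem_head.
by move=> /(pend_le_head el); lia.
Qed.

Lemma nesting_fun_call s i j j' :
  nesting w s (i, j) -> nesting w s (i, j') -> j = j'.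
Proof.
wlog jj' : j j' / j <= j'.
  by move=> h n1 n2; case: (leqP j j') => [|/ltnW] /h ->.
move=> n1 n2; apply/eqP; rewrite eqn_leq jj' leqNgt; apply/negP => lt_jj'.
have [rj [l el]] := (nestingP _ _ _).1 n1.
have [_ [l' el']] := (nestingP _ _ _).1 n2.
have : i \in pend s j.+1.
  apply: (@pend_persist _ _ j'); rewrite ?el' ?mem_head //.
  by have := nesting_lt n1; lia.
rewrite pend_ret // el /= => il; have := pend_sorted s j; rewrite el /=.
rewrite path_sortedE; last by move=> ? ? ?; rewrite /gtn /=; lia.
by move=> /andP[/allP /(_ _ il)] /=; rewrite ltnn.
Qed.

Definition mu_of : set (nat * nat) := mu (nested w).

Lemma mu_ofP i j : mu_of (i, j) <-> exists s, nesting w s (i, j).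
Proof. by split=> [[s _]|[s]] ?; exists s. Qed.

Lemma is_call_inj s s' (a : S) : is_call s a -> is_call s' a -> s = s'.
Proof. by rewrite /is_call; case: kind_of => // t /eqP-> /eqP->. Qed.

Lemma is_ret_inj s s' (a : S) : is_ret s a -> is_ret s' a -> s = s'.
Proof. by rewrite /is_ret; case: kind_of => // t /eqP-> /eqP->. Qed.

Lemma mu_lt i j : mu_of (i, j) -> i < j.
Proof. by move=> /mu_ofP[s /nesting_lt]. Qed.

Lemma call_ret_excl s s' (a : S) : is_call s a -> is_ret s' a -> False.
Proof. by rewrite /is_call /is_ret; case: kind_of. Qed.

Lemma mu_fun_call i j j' : mu_of (i, j) -> mu_of (i, j') -> j = j'.
Proof.
move=> /mu_ofP[s n1] /mu_ofP[s' n2].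
have [[c1 _] [c2 _]] := (nesting_kind n1, nesting_kind n2).
by rewrite (is_call_inj c2 c1) in n2; apply: nesting_fun_call n1 n2.
Qed.

Lemma mu_fun_ret i i' j : mu_of (i, j) -> mu_of (i', j) -> i = i'.
Proof.
move=> /mu_ofP[s n1] /mu_ofP[s' n2].
have [[_ r1] [_ r2]] := (nesting_kind n1, nesting_kind n2).
by rewrite (is_ret_inj r2 r1) in n2; apply: nesting_fun_ret n1 n2.
Qed.

Lemma mu_chain i j k : mu_of (i, j) -> mu_of (j, k) -> False.
Proof.
move=> /mu_ofP[s n1] /mu_ofP[s' n2].
have [[_ r1] [c2 _]] := (nesting_kind n1, nesting_kind n2).
exact: call_ret_excl c2 r1.
Qed.

Definition linked i j : Prop := mu_of (i, j) \/ mu_of (j, i).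

Definition matched i : Prop := exists j, linked i j.

Lemma linked_sym i j : linked i j -> linked j i.
Proof. by case; [right|left]. Qed.

Lemma linked_fun i j j' : linked i j -> linked i j' -> j = j'.
Proof.
move=> [h|h] [h'|h'].
- exact: mu_fun_call h h'.
- by case: (mu_chain h' h).
- by case: (mu_chain h h').
- exact: mu_fun_ret h h'.
Qed.

(** The default [i] makes this a total involution whose fixed points are the unmatched positions. *)
Definition partner i : nat := xget i [set j | linked i j]%classic.

Lemma partnerE i j : linked i j -> partner i = j.
Proof.
move=> ij; apply: (@linked_fun i) => //.
by apply: (xgetI i); exact: ij.
Qed.

Lemma partnerN i : ~ matched i -> partner i = i.
Proof. by move=> ni; rewrite /partner xgetPN // => j ij; apply: ni; exists j. Qed.

Lemma partner_linked i : matched i -> linked i (partner i).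
Proof. by case=> j ij; rewrite (partnerE ij). Qed.

Lemma partnerK : involutive partner.
Proof.
move=> i; have [mi|ni] := pselect (matched i); last by rewrite !partnerN // partnerN.
by apply/partnerE/linked_sym/partner_linked.
Qed.

Lemma linked_neq i j : linked i j -> i <> j.
Proof. by case=> /mu_lt + ij; lia. Qed.

Lemma partner_neq i : partner i <> i <-> matched i.
Proof.
split=> [pi|/partner_linked/linked_neq/nesym//].
by apply: contrapT => /partnerN.
Qed.

(* The line involutions [Some b] swap neighbours, so that successor and
   predecessor together are two involutions; at 0, [Some true] is the identity. *)
Definition act (g : option bool) (i : nat) : nat :=
  if g is Some b then if odd i == b then i.+1 else i.-1 else partner i.

Lemma actK g : involutive (act g).
Proof.
case: g => [b|] i; last exact: partnerK.
rewrite /act; case: i => [|i]; first by case: b.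
by case: (altP (odd i.+1 =P b)) => [<-|] /=; case: b => /=; case: (odd i).
Qed.

Definition actl (u : seq (option bool)) (i : nat) : nat := foldl (fun j g => act g j) i u.

Lemma actl_cat u v i : actl (u ++ v) i = actl v (actl u i).
Proof. by rewrite /actl foldl_cat. Qed.

Lemma actl_revK u : cancel (actl u) (actl (rev u)).
Proof.
elim: u => [//|g u IH] i; rewrite rev_cons -cats1 actl_cat /=.
by rewrite [actl _ _]IH /actl /= actK.
Qed.

End Pending.

(** * Popping of pending calls, and matched positions *)

Section Popping.
Variables (S : alphabet) (w : word S).
Implicit Types (s : 'I_2).

Lemma pend_notin_tail s n i l : pend w s n = i :: l -> i \notin l.
Proof.
move=> /pend_head[_ _ <- _]; apply/negP => /pend_lt; by rewrite ltnn.
Qed.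

Lemma pend_popped s n i : i \in pend w s n -> i \notin pend w s n.+1 -> nesting w s (i, n).
Proof.
rewrite [pend w s n.+1]/=; case: ifP => cn; first by rewrite inE => ->; rewrite orbT.
case: ifP => rn; last by move=> ->.
case e: (pend w s n) => [//|k l] /=; rewrite inE => /orP[/eqP->|->//] _.
by apply/nestingP; split=> //; exists l.
Qed.

Lemma nesting_pend_after s i j n : nesting w s (i, j) -> j < n -> i \notin pend w s n.
Proof.
move=> nij jn; apply/negP => /pend_persist h.
have [rj [l e]] := (nestingP _ _ _ _).1 nij; have := nesting_lt nij => ij.
have : i \in pend w s j.+1 by apply: h => //; lia.
by rewrite pend_ret // e /=; apply/negP/(pend_notin_tail e).
Qed.

Lemma pend_head_popped s n i l j : pend w s n = i :: l -> nesting w s (i, j) ->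
  n <= j /\ pend w s j.+1 = l.
Proof.
move=> e nij; split.
  by rewrite leqNgt; apply/negP => /(nesting_pend_after nij); rewrite e mem_head.
have [rj [l' e']] := (nestingP _ _ _ _).1 nij.
have [_ _ <- _] := pend_head e; have [_ _ pl _] := pend_head e'.
by rewrite pend_ret // e' /= pl.
Qed.

Lemma pend_dropped s i n m : i \in pend w s n -> n <= m -> i \notin pend w s m ->
  exists j, nesting w s (i, j).
Proof.
move=> iin /subnKC <-; elim: (m - n) => [|d IH]; first by rewrite addn0 iin.
have [id|/IH h _] := boolP (i \in pend w s (n + d)); last exact: h.
by rewrite addnS => nd; exists (n + d); apply: pend_popped.
Qed.

Lemma matched_call s i : is_call s (w i) -> matched w i -> exists j, nesting w s (i, j).
Proof.
move=> ci [j [/mu_ofP[s' n]|/mu_ofP[s' n]]]; have [c r] := nesting_kind n.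
  by exists j; rewrite (is_call_inj ci c).
by case: (call_ret_excl ci r).
Qed.

Lemma matched_ret s i : is_ret s (w i) -> matched w i <-> pend w s i <> [::].
Proof.
move=> ri; split.
  move=> [j [/mu_ofP[s' n]|/mu_ofP[s' n]]]; have [c r] := nesting_kind n.
    by case: (call_ret_excl c ri).
  by rewrite -(is_ret_inj r ri); have [_ [l ->]] := (nestingP _ _ _ _).1 n.
case e: (pend w s i) => [//|k l] _; exists k; right; apply/mu_ofP; exists s.
by apply/nestingP; split=> //; exists l.
Qed.

Lemma nesting_matched s i j : nesting w s (i, j) -> matched w i /\ matched w j.
Proof.
by move=> n; split; [exists j; left|exists i; right]; apply/mu_ofP; exists s.
Qed.

(* What lies above a matched call on the stack is popped before it. *)
Lemma matched_above s n k l : pend w s n = k :: l -> matched w k ->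
  is_call s (w n) -> matched w n.
Proof.
move=> e mk ci; have [kn ck _ _] := pend_head e.
have [r nr] := matched_call ck mk.
have [nler _] := pend_head_popped e nr.
have [rr [l' e']] := (nestingP _ _ _ _).1 nr.
have nr' : n < r.
  by rewrite ltn_neqAle nler andbT; apply/eqP => h; subst r; exact: (call_ret_excl ci rr).
have nS : n \in pend w s n.+1 by rewrite pend_call // mem_head.
have nno : n \notin pend w s r.
  by apply/negP => /(pend_le_head e'); lia.
by have [j nj] := pend_dropped nS nr' nno; have [] := nesting_matched nj.
Qed.

(** Induction on the height of the stack: if the top is matched, then right after its return the
    stack is the tail, which is shorter. *)
Lemma unmatched_top_often s :
  infinitely_often (fun n => forall k l, pend w s n = k :: l -> ~ matched w k).
Proof.
move=> n; move e: (size (pend w s n)) => d.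
elim/ltn_ind: d n e => d IH n e.
have [h|h] := pselect (forall k l, pend w s n = k :: l -> ~ matched w k).
  by exists n.
have [k [l [ekl mk]]] : exists k l, pend w s n = k :: l /\ matched w k.
  apply: contrapT => nh; apply: h => k l ekl mk; apply: nh; by exists k, l.
have [_ ck _ _] := pend_head ekl.
have [r nr] := matched_call ck mk.
have [nler er] := pend_head_popped ekl nr.
have [||m rm hm] := IH (size l) _ r.+1; first by rewrite -e ekl.
  by rewrite er.
by exists m => //; lia.
Qed.
End Popping.

(** * Turning of plane curves along the line *)

Section Curve.
Local Open Scope ring_scope.

Variables (y : nat -> nat) (sd : nat -> bool).

Definition strictly_between (a b x : nat) : bool :=
  ((a < x) && (x < b) || (b < x) && (x < a))%N.

Definition heading (a b : nat) : int := if (a < b)%N then 1 else -1.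

Definition side_sign (b : bool) : int := if b then 1 else -1.

(* Half-turns of the secant from [x] to a point moving along step [t]. *)
Definition sweep (t x : nat) : int :=
  if strictly_between (y t) (y t.+1) x then side_sign (sd t) * heading (y t) (y t.+1) else 0.

(* Half-turns of the curve at the vertex [y t.+1]. *)
Definition turning (t : nat) : int := sweep t.+1 (y t) + sweep t (y t.+2).

Definition crossing (a b c d : nat) : bool :=
  (minn a b < minn c d)%N && (minn c d < maxn a b)%N && (maxn a b < maxn c d)%N.

Hypothesis noncrossing : forall s t, sd s = sd t ->
  ~~ crossing (y s) (y s.+1) (y t) (y t.+1).

(* Rotating the secant [y s, y t] by moving its two ends commutes. *)
Lemma sweep_square s t :
  y s <> y t -> y s <> y t.+1 -> y s.+1 <> y t -> y s.+1 <> y t.+1 ->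
  sweep t (y s) + sweep s (y t.+1) = sweep s (y t) + sweep t (y s.+1).
Proof.
have := @noncrossing s t; have := @noncrossing t s.
rewrite /sweep; move: (y s) (y s.+1) (y t) (y t.+1) => a a' b b'.
rewrite /crossing /strictly_between /heading.
rewrite /side_sign; case: (sd s); case: (sd t) => /= h1 h2 ? ? ? ?;
  try have {}h1 := h1 erefl; try have {}h2 := h2 erefl;
  case: (ltnP a a') => ?; case: (ltnP b b') => ?; do 4 case: ifP => ?; lia.
Qed.

Definition inj_on (a b : nat) : Prop :=
  forall i j, (a <= i <= b)%N -> (a <= j <= b)%N -> y i = y j -> i = j.

Lemma inj_onS a b : inj_on a b.+1 -> inj_on a b.
Proof. by move=> h i j hi hj; apply: h; lia. Qed.

Lemma inj_onE a b i j : inj_on a b -> (a <= i <= b)%N -> (a <= j <= b)%N -> i <> j -> y i <> y j.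
Proof. by move=> h hi hj ij /(h _ _ hi hj). Qed.

(* The total turning of a path, computed by rotating secants: first the far
   end moves along the path, seen from [y a], then the near end follows. *)
Lemma sum_turning a d : inj_on a (a + d.+1) ->
  \sum_(a <= s < a + d) turning s =
  \sum_(a.+1 <= t < a + d.+1) sweep t (y a)
  + \sum_(a <= s < a + d) sweep s (y (a + d.+1)).
Proof.
elim: d => [|d IH] inj; first by rewrite addn0 addn1 !big_geq.
rewrite !addnS in IH inj *.
have le_ad : (a <= a + d)%N by lia.
rewrite big_nat_recr //= IH; last exact: inj_onS.
rewrite [X in _ = X + _]big_nat_recr //=.
rewrite [X in _ = _ + X]big_nat_recr //=.
have -> : \sum_(a <= s < a + d) sweep s (y (a + d).+2) =
    \sum_(a <= s < a + d) sweep s (y (a + d).+1)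
    + \sum_(a <= s < a + d) (sweep (a + d).+1 (y s.+1) - sweep (a + d).+1 (y s)).
  rewrite -big_split /= !big_nat; apply: eq_bigr => s hs.
  have sq : sweep (a + d).+1 (y s) + sweep s (y (a + d).+2)
      = sweep s (y (a + d).+1) + sweep (a + d).+1 (y s.+1).
    by apply: sweep_square; apply: (inj_onE inj); lia.
  by rewrite addrA -sq addrAC subrr add0r.
rewrite (telescope_sumr (fun s => sweep (a + d).+1 (y s))) //.
rewrite /turning; ring.
Qed.

Lemma sweep_leftmost t x : (x <= y t)%N -> (x <= y t.+1)%N -> sweep t x = 0.
Proof. by move=> h1 h2; rewrite /sweep /strictly_between ifN //; lia. Qed.

Lemma sweep_rightmost t x : (y t <= x)%N -> (y t.+1 <= x)%N -> sweep t x = 0.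
Proof. by move=> h1 h2; rewrite /sweep /strictly_between ifN //; lia. Qed.

(** The two ends are extreme, so no step has either of them strictly inside, and both sums of
    [sum_turning] vanish. *)
Lemma sum_turning_open a d : inj_on a (a + d.+1) ->
  (forall t, (a <= t <= a + d.+1)%N -> (y a <= y t <= y (a + d.+1))%N) ->
  \sum_(a <= s < a + d) turning s = 0.
Proof.
move=> inj hy; rewrite sum_turning // !big_nat !big1 ?addr0 //.
  move=> s hs; apply: sweep_rightmost.
    by have := hy s; lia.
  by have := hy s.+1; lia.
move=> s hs; apply: sweep_leftmost.
  by have := hy s; lia.
by have := hy s.+1; lia.
Qed.

(** The curve starts at its leftmost point, where the turning is [turning b]. It is 1 or -1: of the
    two neighbours the nearer one lies strictly inside the step to the other. Rotating secants shows
    that the rest of the curve contributes the same amount once more. *)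
Lemma sum_turning_closed a n : (3 <= n)%N -> inj_on a (a + n).-1 ->
  (forall t, y (t + n) = y t) -> (forall t, sd (t + n) = sd t) ->
  (forall t, (y a <= y t)%N) ->
  \sum_(a <= s < a + n) turning s \in [:: 2; -2].
Proof.
case: n => [//|[//|[//|n]]] _; rewrite [(_ + _).-1]/= !addnS /= => inj per sdper ymin.
set b := (a + n).+2.
have eb : b.+1 = (a + n.+3)%N by rewrite /b !addnS.
have inj' : inj_on a (a + n.+1) by rewrite addnS; apply: inj_onS.
have yb : y b.+1 = y a by rewrite eb per.
have yb2 : y b.+2 = y a.+1 by rewrite -(per a.+1) addSn -eb.
have sb : sd b.+1 = sd a by rewrite eb sdper.
have swb x : sweep b.+1 x = sweep a x by rewrite /sweep yb yb2 sb.
have ne i j : (a <= i <= b)%N -> (a <= j <= b)%N -> i <> j -> y i <> y j by exact: inj_onE.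
have tb : turning b = sweep a (y b) + sweep b (y a.+1) by rewrite /turning swb yb2.
have tb1 : turning b = 1 \/ turning b = -1.
  have nb1 : y b <> y a.+1 by apply: ne; lia.
  have nba : y b <> y a by apply: ne; lia.
  have na1 : y a.+1 <> y a by apply: ne; lia.
  have := ymin b; have := ymin a.+1.
  rewrite tb /sweep yb /strictly_between /heading.
  move: (y a) (y a.+1) (y b) (sd a) (sd b) nb1 nba na1 => u v v' [] [] ? ? ? ? ?;
    rewrite /side_sign; do !case: ifP => ?; lia.
have le_ab : (a <= (a + n).+2)%N by lia.
suff -> : \sum_(a <= s < (a + n).+3) turning s = turning b + turning b.
  by rewrite !inE; case: tb1 => ->.
have eb1 : b = (a + n.+1).+1 by rewrite /b addnS.
rewrite -[(a + n).+3]/(b.+1) big_nat_recr //=; congr (_ + _).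
rewrite eb1 big_nat_recr /=; last by lia.
rewrite sum_turning; last by rewrite !addnS.
rewrite addnS -eb1 [X in X + _ + _]big_nat big1 ?add0r; last first.
  by move=> s _; apply: sweep_leftmost.
have -> : turning (a + n.+1) = sweep b (y (a + n.+1)).
  rewrite /turning -eb1 yb [X in _ + X]sweep_leftmost ?addr0 //.
rewrite big_ltn; last by lia.
rewrite tb -addrA; congr (_ + _).
(* The closing step [b] ends at the leftmost point, which no step sweeps over, so in [sweep_square]
   one term vanishes and the sum telescopes. *)
have -> : \sum_(a.+1 <= s < a + n.+1) sweep s (y b)
    = \sum_(a.+1 <= s < a + n.+1) (- sweep b (y s.+1) - - sweep b (y s)).
  rewrite !big_nat; apply: eq_bigr => s hs.
  have sq : sweep b (y s) + sweep s (y b.+1) = sweep s (y b) + sweep b (y s.+1).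
    by apply: sweep_square; rewrite ?yb; apply: ne; lia.
  move: sq; rewrite yb (@sweep_leftmost s (y a)) // addr0 => ->; ring.
rewrite (telescope_sumr (fun s => - sweep b (y s))); last by lia.
ring.
Qed.

(* An infinite injective path goes from its leftmost point to rightmost points
   arbitrarily far along it, with total turning 0 each time. *)
Lemma sum_turning_infinite a : (forall i j, y i = y j -> i = j) ->
  (forall t, (y a <= y t)%N) ->
  forall N, exists2 d, (N <= d)%N & \sum_(a <= s < a + d) turning s = 0.
Proof.
move=> inj ymin N.
(* The point [m] is the first one beyond the maximum [M] of the first values; it exists as an
   injective sequence cannot stay below a bound. *)
have [m mN ym] : exists2 m, (a + N.+1 <= m)%N &
    forall t, (a <= t <= m)%N -> (y t <= y m)%N.
  pose M := (\max_(t < (a + N.+1)) y t).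
  have Mt t : (t < a + N.+1)%N -> (y t <= M)%N.
    by move=> h; exact: (@leq_bigmax _ (fun t : 'I_(a + N.+1) => y t) (Ordinal h)).
  have exm : exists m, (M < y m)%N.
    apply: contrapT => nm.
    have le t : (y t < M.+1)%N by rewrite ltnS leqNgt; apply/negP => h; apply: nm; exists t.
    pose f (i : 'I_M.+2) : 'I_M.+1 := Ordinal (le i).
    have : injective f by move=> i j [/inj/val_inj].
    by move=> /leq_card; rewrite !card_ord ltnn.
  have := ex_minnP exm => -[m Mm mmin]; exists m.
    by rewrite leqNgt; apply/negP => /Mt; lia.
  move=> t /andP[_]; rewrite leq_eqVlt => /orP[/eqP->//|tm].
  rewrite leqNgt; apply/negP => h; have := mmin t; lia.
have [d ed] : exists d, m = (a + d.+1)%N by exists (m - a).-1; lia.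
exists d; first lia.
apply: sum_turning_open; first by move=> i j _ _; exact: inj.
by move=> t; rewrite -ed => /ym->; rewrite ymin.
Qed.
End Curve.

(** * Walks in a nested word *)

Lemma exists_argmin (f : nat -> nat) : exists a, forall t, f a <= f t.
Proof.
have ex : exists m, `[< exists t, f t = m >] by exists (f 0); apply/asboolP; exists 0.
case: (ex_minnP ex) => m /asboolP[a <-] h; exists a => t.
by apply: h; apply/asboolP; exists t.
Qed.

Section PeriodicSum.
Local Open Scope ring_scope.
Variables (r : nat -> int) (n : nat).
Hypothesis per : forall t, r (t + n) = r t.

Lemma sum_periodic_shift a : \sum_(a <= s < a + n) r s = \sum_(0 <= s < n) r s.
Proof.
elim: a => [|a IH]; first by rewrite add0n.
rewrite -IH; case: n per => [|m] per'; first by rewrite !addn0 !big_geq.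
rewrite addSn big_nat_recr /=; last by rewrite addnS; lia.
rewrite [RHS]big_ltn; last by lia.
by rewrite per' addrC.
Qed.

Lemma sum_periodic a k : \sum_(a <= s < a + k * n) r s = k%:Z * \sum_(0 <= s < n) r s.
Proof.
elim: k => [|k IH]; first by rewrite mul0n addn0 big_geq // mul0r.
rewrite mulSn addnCA addnC (@big_cat_nat _ _ _ (a + k * n)%N) /=; try lia.
by rewrite IH sum_periodic_shift -[k.+1]addn1 PoszD mulrDl mul1r.
Qed.

Lemma sum_bounded a j : (forall s, (-2 <= r s <= 2)) ->
  (- (2 * j)%N%:Z <= \sum_(a <= s < a + j) r s <= (2 * j)%N%:Z).
Proof.
move=> br; elim: j => [|j IH]; first by rewrite addn0 big_geq.
rewrite addnS big_nat_recr /=; last by lia.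
move: IH (br (a + j)%N); move: (r (a + j)%N); set x := bigop _ _ _; move: x => x z.
by lia.
Qed.
End PeriodicSum.

(** * Turning of walks, read off letters and parities *)

Section Turning.
Local Open Scope ring_scope.
Variable S : alphabet.

(* The heading and the bending of a step, as read off the letter and the parity
   of the position where it starts. *)
Definition step_heading (a : S) (par : bool) (g : option bool) : int :=
  if g is Some b then if par == b then 1 else -1
  else if kind_of a is Call _ then 1 else -1.

Definition step_bend (a : S) (g : option bool) : int :=
  if g is Some _ then 0 else
  match kind_of a with
  | Call s => side_sign (s == ord0)
  | Ret s => - side_sign (s == ord0)
  | Internal => 0
  end.

Definition vertex_turning a par g a' par' g' : int :=
  if step_heading a par g == step_heading a' par' g' then 0
  else step_bend a g + step_bend a' g'.

Lemma vertex_turning_bounded a par g a' par' g' :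
  -2 <= vertex_turning a par g a' par' g' <= 2.
Proof.
have b c h : -1 <= @step_bend c h <= 1.
  rewrite /step_bend /side_sign; case: h => [//|].
  by case: kind_of => [s|s|//]; case: (s == ord0).
by rewrite /vertex_turning; have := b a g; have := b a' g'; case: ifP; lia.
Qed.

Variable w : word S.

Lemma arc_spec x : partner w x <> x ->
  exists s, (nesting w s (x, partner w x) /\ kind_of (w x) = Call s)
         \/ (nesting w s (partner w x, x) /\ kind_of (w x) = Ret s).
Proof.
move=> /partner_neq/partner_linked[] /mu_ofP[s n]; exists s; [left|right]; split=> //.
- by case: n => /= _ + _ _; rewrite /is_call; case: kind_of => // t /eqP->.
- by case: n => /= _ _ + _; rewrite /is_ret; case: kind_of => // t /eqP->.
Qed.

Lemma heading_act g x : act w g x <> x ->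
  heading x (act w g x) = step_heading (w x) (odd x) g.
Proof.
case: g => [b|] /=; rewrite /heading.
  case: ifP => _ h; first by rewrite ltnSn.
  by rewrite ifF //; lia.
move=> /arc_spec[s [[/nesting_lt lt ->]|[/nesting_lt lt ->]]]; first by rewrite lt.
by rewrite ifF //; lia.
Qed.

(** [true] is the side of stack 0. It also serves as default for steps along the line, which have no
    position strictly inside. *)
Definition step_side (g : option bool) (a : S) : bool :=
  if g is Some _ then true else
  match kind_of a with Call s | Ret s => s == ord0 | Internal => true end.

Lemma bend_act x : partner w x <> x ->
  step_bend (w x) None
  = side_sign (step_side None (w x)) * step_heading (w x) (odd x) None.
Proof.
by move=> /arc_spec[s [[_ e]|[_ e]]];
  rewrite /step_bend /step_side /step_heading /= e ?mulr1 ?mulrN1.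
Qed.

Variable g : nat -> option bool.
Variable x0 : nat.

Fixpoint walk t : nat := if t is t'.+1 then act w (g t') (walk t') else x0.

Definition side t : bool := step_side (g t) (w (walk t)).

Lemma act_adjacent b x : act w (Some b) x = x.+1 \/ act w (Some b) x = x.-1.
Proof. by rewrite /act; case: ifP; [left|right]. Qed.

(** A line step has no position strictly inside. Two arcs on one side belong to the same stack, as
    there are only two stacks, and one stack has no crossing arcs. *)
Lemma walk_noncrossing s t : side s = side t ->
  ~~ crossing (walk s) (walk s.+1) (walk t) (walk t.+1).
Proof.
rewrite /side /= /crossing.
case gs: (g s) => [b|].
  by have [] := act_adjacent b (walk s) => -> _; lia.
case gt: (g t) => [b|].
  by have [] := act_adjacent b (walk t) => -> _; lia.
move: (walk s) (walk t) => a c /=.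
have [ea|na] := pselect (partner w a = a); first by rewrite ea; lia.
have [ec|nc] := pselect (partner w c = c); first by rewrite ec; lia.
have [s1 h1] := arc_spec na; have [s2 h2] := arc_spec nc => eq.
have es : s1 = s2.
  case: h1 h2 eq => -[_ e1] [] -[_ e2]; rewrite /step_side e1 e2;
    case: s1 {e1} => -[|[|//]] i; case: s2 {e2} => -[|[|//]] j //= _; exact: val_inj.
subst s2; apply/negP => /andP[/andP[c1 c2] c3].
have n1 : nesting w s1 (minn a (partner w a), maxn a (partner w a)).
  case: h1 => -[n _]; have lt := nesting_lt n.
    by rewrite (minn_idPl (ltnW lt)) (maxn_idPr (ltnW lt)).
  by rewrite (minn_idPr (ltnW lt)) (maxn_idPl (ltnW lt)).
have n2 : nesting w s1 (minn c (partner w c), maxn c (partner w c)).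
  case: h2 => -[n _]; have lt := nesting_lt n.
    by rewrite (minn_idPl (ltnW lt)) (maxn_idPr (ltnW lt)).
  by rewrite (minn_idPr (ltnW lt)) (maxn_idPl (ltnW lt)).
have := ltn_trans (nesting_noncrossing n1 n2 c1 c2) c3.
by rewrite ltnn.
Qed.

(** If the heading is kept, the neighbours of the vertex lie on different sides of it and nothing is
    swept. If it is reversed, exactly one of the two steps is an arc, since two arcs or two line
    steps would return to where they came from; the arc reaches beyond the neighbour on the line and
    sweeps over it. *)
Lemma turning_walk t :
  walk t <> walk t.+1 -> walk t.+1 <> walk t.+2 -> walk t <> walk t.+2 ->
  turning walk side t =
  vertex_turning (w (walk t)) (odd (walk t)) (g t)
                 (w (walk t.+1)) (odd (walk t.+1)) (g t.+1).
Proof.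
move=> n1 n2 n3; rewrite /turning /sweep /vertex_turning.
have h1 : heading (walk t) (walk t.+1) = step_heading (w (walk t)) (odd (walk t)) (g t).
  by apply: heading_act => /esym.
have h2 : heading (walk t.+1) (walk t.+2)
    = step_heading (w (walk t.+1)) (odd (walk t.+1)) (g t.+1).
  by apply: heading_act => /esym.
have b1 : g t = None -> side_sign (side t) * heading (walk t) (walk t.+1)
    = step_bend (w (walk t)) (g t).
  move=> e; rewrite h1 /side e bend_act // => ep.
  by apply: n1; rewrite /= e /= ep.
have b2 : g t.+1 = None -> side_sign (side t.+1) * heading (walk t.+1) (walk t.+2)
    = step_bend (w (walk t.+1)) (g t.+1).
  move=> e; rewrite h2 /side e bend_act // => ep.
  by apply: n2; rewrite [walk t.+2]/= e /= ep.
rewrite -h1 -h2.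
have a1 b : g t = Some b -> walk t.+1 = (walk t).+1 \/ walk t.+1 = (walk t).-1.
  by move=> e; rewrite /= e; apply: act_adjacent.
have a2 b : g t.+1 = Some b -> walk t.+2 = (walk t.+1).+1 \/ walk t.+2 = (walk t.+1).-1.
  by move=> e; rewrite [walk t.+2]/= e; apply: act_adjacent.
case e1: (g t) b1 a1 => [b|] b1 a1; case e2: (g t.+1) b2 a2 => [b'|] b2 a2.
- have [{}a1 {}a2] := (a1 _ erefl, a2 _ erefl).
  rewrite [X in X + _]ifF; last by rewrite /strictly_between; lia.
  rewrite [X in _ + X]ifF; last by rewrite /strictly_between; lia.
  by rewrite /step_bend addr0; case: ifP.
- have {}a1 := a1 _ erefl; rewrite b2 // [X in _ + X]ifF; last by rewrite /strictly_between; lia.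
  rewrite addr0 [step_bend _ (Some _)]/= add0r.
  have -> : strictly_between (walk t.+1) (walk t.+2) (walk t)
    = (heading (walk t) (walk t.+1) != heading (walk t.+1) (walk t.+2)).
    by rewrite /strictly_between /heading; do 2 case: ifP => ?; apply/idP/idP; lia.
  by case: eqP.
- have {}a2 := a2 _ erefl; rewrite b1 // [X in X + _]ifF; last by rewrite /strictly_between; lia.
  rewrite add0r [step_bend _ (Some _)]/= addr0.
  have -> : strictly_between (walk t) (walk t.+1) (walk t.+2)
    = (heading (walk t) (walk t.+1) != heading (walk t.+1) (walk t.+2)).
    by rewrite /strictly_between /heading; do 2 case: ifP => ?; apply/idP/idP; lia.
  by case: eqP.
- by case: n3; rewrite /= e1 e2 actK.
Qed.

Lemma walk_inj s t : (forall i, g (s + i) = g (t + i)) -> walk s = walk t ->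
  forall i, walk (s + i) = walk (t + i).
Proof.
move=> gst e; elim=> [|i IH]; first by rewrite !addn0.
by rewrite !addnS /= IH gst.
Qed.

(** Steps are involutions, so two positions that agree after the same [s] last steps already agreed
    before them. *)
Lemma walk_back s d : (forall i, (i < s)%N -> g i = g (d + i)) ->
  walk s = walk (d + s) -> walk d = x0.
Proof.
elim: s => [|s IH] h e; first by rewrite addn0 in e; rewrite -e.
apply: IH; first by move=> i /leqW; apply: h.
move: e; rewrite addnS /= -h // => e.
by rewrite -[walk s](actK w (g s)) e actK.
Qed.
End Turning.

(** * Colourings certifying equality of walks *)

Definition cyc_gen (u : seq (option bool)) (t : nat) : option bool :=
  nth None u (t %% size u).

Section View.
Variables (S : alphabet) (T K : eqType).
Variables (sym : T -> S) (par : T -> bool) (col : T -> K).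

(* [I v] is the information found at the end of the walk [v]. *)
Implicit Type I : seq (option bool) -> T.

(** The last summand belongs to the vertex where the closed curve passes from the end of [u] to its
    beginning, hence the cyclic generators. *)
Definition view_turning I u : int :=
  (\sum_(0 <= t < size u)
    vertex_turning (sym (I (take t u))) (par (I (take t u))) (cyc_gen u t)
      (sym (I (take t.+1 u))) (par (I (take t.+1 u))) (cyc_gen u t.+1))%R.

(* If the walk [u] returns to the colour it started from and meets no other
   colour twice, then it should be a simple closed curve. *)
Definition simple_view I u : bool :=
  [&& (2 <= size u), cyc_gen u 0 != cyc_gen u 1, col (I u) == col (I [::])
    & uniq [seq col (I (take t u)) | t <- iota 0 (size u)]].

Variable w : word S.
Variables (lab : nat -> T) (L : nat).
Hypothesis symE : forall x, sym (lab x) = w x.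
Hypothesis parE : forall x, par (lab x) = odd x.

Definition view x : seq (option bool) -> T := fun v => lab (actl w v x).

Definition proper_coloring : Prop :=
  forall x u, (size u <= L) -> col (lab (actl w u x)) = col (lab x) -> actl w u x = x.

Definition adjacent_distinct : Prop :=
  forall x g, act w g x <> x -> col (lab (act w g x)) <> col (lab x).

Definition transported : Prop :=
  forall x u h, (size u <= L) -> (size h <= L) -> col (view x u) = col (view x [::]) ->
    view x (u ++ h) = view x h.

Definition cycles_turn : Prop :=
  forall x u, (size u <= L) -> simple_view (view x) u ->
    view_turning (view x) u \in [:: 2; -2]%R.

Section Walk.
Variables (x : nat) (u : seq (option bool)).
Let n := size u.
Let y := walk w (cyc_gen u) x.
Let sd := side w (cyc_gen u) x.

Lemma cyc_gen_add k t : cyc_gen u (k * n + t) = cyc_gen u t.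
Proof. by rewrite /cyc_gen /n modnMDl. Qed.

Lemma walk_actl s t : (t <= n) -> y (s * n + t) = actl w (take t u) (y (s * n)).
Proof.
elim: t => [|t IH] lt; first by rewrite addn0 take0.
rewrite (take_nth None lt) -cats1 actl_cat -IH; last exact: ltnW.
by rewrite addnS /y /= -/y cyc_gen_add /cyc_gen modn_small.
Qed.

Lemma walk_take t : (t <= n) -> y t = actl w (take t u) x.
Proof. by move=> /(walk_actl 0); rewrite mul0n. Qed.

Lemma walk_size : y n = actl w u x.
Proof. by rewrite walk_take // take_size. Qed.

Lemma walk_block k : y (k.+1 * n) = actl w u (y (k * n)).
Proof. by rewrite mulSn addnC walk_actl // take_size. Qed.

Let r t := vertex_turning (sym (lab (y t))) (par (lab (y t))) (cyc_gen u t)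
             (sym (lab (y t.+1))) (par (lab (y t.+1))) (cyc_gen u t.+1).

Lemma view_turningE : view_turning (view x) u = (\sum_(0 <= t < n) r t)%R.
Proof.
rewrite /view_turning !big_nat; apply: eq_bigr => t /andP[_ lt].
by rewrite /r /view !walk_take // ltnW.
Qed.

Lemma turning_r t : y t <> y t.+1 -> y t.+1 <> y t.+2 -> y t <> y t.+2 ->
  turning y sd t = r t.
Proof. by move=> *; rewrite /r !symE !parE turning_walk. Qed.

Hypothesis n2 : (2 <= n).
Hypothesis labper : forall t, lab (y (n + t)) = lab (y t).
Hypothesis colinj : forall s t, (s < n) -> (t < n) ->
  col (lab (y s)) = col (lab (y t)) -> s = t.

Lemma lab_mod t : lab (y t) = lab (y (t %% n)).
Proof.
have kt k i : lab (y (k * n + i)) = lab (y i).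
  by elim: k => [//|k IH]; rewrite mulSn -addnA labper.
by rewrite {1}(divn_eq t n) kt.
Qed.

(** The colours within one round are distinct and recur in every round. *)
Lemma walk_mod s t : y s = y t -> s = t %[mod n].
Proof.
by move=> e; apply: colinj; rewrite ?ltn_mod -?lab_mod ?e //; lia.
Qed.

Lemma r_per t : r (t + n) = r t.
Proof.
rewrite addnC /r -addnS !labper; congr (vertex_turning _ _ _ _ _ _).
- by rewrite -[X in (X + _)]mul1n cyc_gen_add.
- by rewrite -[X in (X + _)]mul1n cyc_gen_add.
Qed.

Lemma walk_succ t : y t <> y t.+1.
Proof.
move=> /walk_mod /eqP; have := eqn_modDl t 0 1 n.
by rewrite addn0 addn1 mod0n (modn_small n2) => ->.
Qed.

Lemma walk_return d : (0 < d) -> y d = x -> exists2 k, (0 < k) & d = (k * n).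
Proof.
move=> d0 e; have : d = 0 %[mod n] by apply: walk_mod; rewrite e.
rewrite mod0n => /eqP/dvdnP[k ek]; exists k => //.
by case: k ek d0 => // ->.
Qed.

Lemma walk_periodic d : y d = x -> forall t, y (t + d) = y t.
Proof.
case: d => [|d] e t; first by rewrite addn0.
have [k _ ek] := walk_return (ltn0Sn d) e.
rewrite addnC; symmetry; apply: (@walk_inj _ w (cyc_gen u) x 0 d.+1) => // i.
by rewrite ek cyc_gen_add.
Qed.

Lemma walk_collision s t : (s < t) -> y s = y t -> y (t - s) = x.
Proof.
move=> st e; apply: (@walk_back _ w (cyc_gen u) x s) => [i _|]; last first.
  by rewrite subnK // ltnW.
have /eqP := walk_mod e; rewrite eq_sym eqn_mod_dvd; last exact: ltnW.
by move=> /dvdnP[k ->]; rewrite cyc_gen_add.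
Qed.

(** Up to the first return the curve is simple, because by [walk_collision] an earlier coincidence
    gives an earlier return. By periodicity its turning may be summed from the leftmost point, and
    is [k] times that of one round. *)
Lemma closed_walk_turning k d : d = (k * n) -> (3 <= d) -> y d = x ->
  (forall d', (0 < d' < d) -> y d' <> x) ->
  (k%:Z * view_turning (view x) u)%R \in [:: 2; -2]%R.
Proof.
move=> ed d3 e mind; have per := walk_periodic e.
have [a ymin] := exists_argmin y.
have nret s t : (s < t) -> (t < s + d) -> y s <> y t.
  by move=> st ts /(walk_collision st); apply: mind; lia.
have turn t : turning y sd t = r t.
  by apply: turning_r; apply: nret; lia.
rewrite view_turningE -(@sum_periodic _ _ r_per a) -ed.
under eq_bigr do rewrite -turn.
apply: sum_turning_closed => //.
- exact: walk_noncrossing.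
- move=> i j hi hj eij; have [ij|ij|//] := ltngtP i j.
    by case: (@nret i j _ _ eij); lia.
  by case: (@nret j i _ _ (esym eij)); lia.
- move=> t; rewrite /sd /side -/y per; congr step_side.
  by rewrite addnC ed cyc_gen_add.
Qed.

(** Without a return the walk is injective, so its turning is 0 over arbitrarily long stretches,
    while the turnings of the rounds add up. *)
Lemma infinite_walk_turning : (forall d, (0 < d) -> y d <> x) ->
  view_turning (view x) u = 0%R.
Proof.
move=> nret.
have inj s t : y s = y t -> s = t.
  move=> e; have [st|st|//] := ltngtP s t.
    by have := walk_collision st e; case/nret; lia.
  by have := walk_collision st (esym e); case/nret; lia.
have turn t : turning y sd t = r t by apply: turning_r => /inj h; lia.
have [a ymin] := exists_argmin y.
have nc := @walk_noncrossing _ w (cyc_gen u) x.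
(* So many rounds that a nonzero turning per round would outweigh the incomplete last round, whose
   turning is less than [2 * n] in size. *)
have [d Nd] := sum_turning_infinite nc inj ymin ((2 * n).+1 * n).
under eq_bigr do rewrite turn.
rewrite {1}(divn_eq d n) addnA (@big_cat_nat _ _ _ (a + d %/ n * n)) /=; try lia.
rewrite (@sum_periodic _ _ r_per) -view_turningE.
have lt_mod : (d %% n < n) by rewrite ltn_mod; lia.
have le_div : ((2 * n).+1 <= d %/ n) by rewrite leq_divRL //; lia.
have := @sum_bounded r (a + d %/ n * n) (d %% n) (fun _ => vertex_turning_bounded _ _ _ _ _ _).
move: (bigop _ _ _) (view_turning _ _) => z v bz e.
have [//|v0] := eqVneq v 0%R; exfalso.
move: le_div lt_mod bz e v0; move: (d %/ n) (d %% n) => q m.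
nia.
Qed.

End Walk.

(* A shortest walk [u] violating properness can be repeated for ever: the result
   is a simple closed curve made of at least two copies of [u], or an infinite
   injective path, and the turning +-2 of [u] is compatible with neither. *)
Theorem colouring_proper :
  adjacent_distinct -> transported -> cycles_turn -> proper_coloring.
Proof.
move=> adj tra cyc x u; move en : (size u) => n.
elim/ltn_ind: n x u en => -[|[|n']] IH x u en leL ecol.
- by rewrite (size0nil en).
- case: u en ecol => [//|g [|//]] _ /= ecol.
  by apply: contrapT => /adj; apply.
apply: contrapT => nx; set n := n'.+2 in IH en leL.
pose y := walk w (cyc_gen u) x.
have ytake t : (t <= n) -> y t = actl w (take t u) x by rewrite -en; exact: walk_take.
have yn : y n = actl w u x by rewrite -en; apply: walk_size.
(* A proper part of [u] that returns to its colour is closed by induction. Cutting it out leaves a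
   shorter walk with the same end, which is closed by induction as well, against [nx]. *)
have sub s t : (s < t) -> (t <= n) -> (t - s < n) ->
    col (lab (y s)) = col (lab (y t)) -> False.
  move=> st tn stn e.
  have cut : take t u = take s u ++ drop s (take t u).
    by rewrite -{1}(cat_take_drop s (take t u)) -take_min (minn_idPl (ltnW st)).
  have yst : y t = actl w (drop s (take t u)) (y s).
    rewrite !ytake //; last by lia.
    by rewrite {1}cut actl_cat.
  have sz : size (drop s (take t u)) = (t - s).
    by rewrite size_drop size_takel // en.
  have est : y t = y s.
    by rewrite yst; apply: (IH (t - s)) => //; [lia|rewrite -yst].
  have short : actl w (take s u ++ drop t u) x = actl w u x.
    rewrite actl_cat -ytake -?est ?ytake //; last by lia.
    by rewrite -actl_cat cat_take_drop.
  apply: nx; rewrite -short.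
  have sz' : size (take s u ++ drop t u) = (s + (n - t)).
    by rewrite size_cat size_drop size_takel en //; lia.
  by apply: (IH _ _ _ _ sz'); [lia|lia|rewrite short].
(* As [u] returns to its colour, transport makes every round start with the same view as the
   first. *)
have block k h : (size h <= L) -> lab (actl w h (y (k * n))) = lab (actl w h x).
  elim: k h => [//|k IHk] h leh.
  have yk : y (k.+1 * n) = actl w u (y (k * n)) by rewrite -en; apply: walk_block.
  rewrite yk -actl_cat -IHk //.
  apply: (tra (y (k * n)) u h); rewrite /view ?en //=.
  have := IHk u; rewrite en => -> //.
  by have := IHk [::] => /= ->.
have labper t : lab (y (n + t)) = lab (y t).
  have lk k i : (i < n) -> lab (y (k * n + i)) = lab (y i).
    move=> lt; have := @walk_actl x u k i; rewrite en -/y => -> //; last exact: ltnW.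
    rewrite block; first by rewrite ytake // ltnW.
    by rewrite size_takel ?en //; lia.
  have tn : (t %% n < n) by rewrite ltn_mod.
  have et := divn_eq t n; move: (t %/ n) (t %% n) tn et => q i tn ->.
  by rewrite addnA -mulSn !lk.
have colinj s t : (s < n) -> (t < n) -> col (lab (y s)) = col (lab (y t)) -> s = t.
  move=> ls lt e; have [st|st|//] := ltngtP s t.
    by case: (sub _ _ st _ _ e); lia.
  by case: (sub _ _ st _ _ (esym e)); lia.
have ret2 : y 2 = x -> n' <> 0%N -> False.
  by move=> e n0; apply: (@sub 0 2); rewrite ?e //; lia.
have sv : simple_view (view x) u.
  apply/and4P; split; rewrite ?en //.
  - apply/negP => /eqP e; have e2 : y 2 = x by rewrite /y /= -e actK.
    have n0 : n' = 0 by apply: contrapT; apply: ret2.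
    by apply: nx; rewrite -yn /n n0.
  - by apply/eqP.
  - rewrite map_inj_in_uniq ?iota_uniq // => s t; rewrite !mem_iota !add0n => ls lt.
    rewrite /view -!ytake; try lia.
    by apply: colinj; lia.
have T2 : view_turning (view x) u \in [:: 2; -2]%R by apply: cyc; rewrite ?en.
have n2 : (2 <= size u) by rewrite en.
have labper' t : lab (walk w (cyc_gen u) x (size u + t)) = lab (walk w (cyc_gen u) x t).
  by rewrite en; apply: labper.
have colinj' s t : (s < size u) -> (t < size u) ->
    col (lab (walk w (cyc_gen u) x s)) = col (lab (walk w (cyc_gen u) x t)) -> s = t.
  by rewrite en; apply: colinj.
have [[d0 d0P]|noret] := pselect (exists d, (0 < d) && (y d == x)); last first.
  have := infinite_walk_turning n2 labper' colinj'.
  move=> h; have {}h : view_turning (view x) u = 0%R.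
    by apply: h => d d0 e; apply: noret; exists d; rewrite d0 /y e eqxx.
  by rewrite h in T2.
have ex : exists d, (0 < d) && (y d == x) by exists d0.
case: (ex_minnP ex) => d /andP[dpos /eqP yd] dmin.
have [k kpos ed] := walk_return n2 labper' colinj' dpos yd.
(* One round does not close, so [k > 1], and [k] times [+-2] cannot be [+-2]. *)
have k1 : k <> 1%N by move=> k1; apply: nx; rewrite -yn -yd ed k1 mul1n en.
have d3 : (3 <= d) by rewrite ed en /n; nia.
have := closed_walk_turning n2 labper' colinj' ed d3 yd.
have mind : forall d', (0 < d' < d) -> y d' <> x.
  by move=> d' /andP[d'0 d'd] e; have := dmin d'; rewrite d'0 e eqxx => /(_ isT); lia.
move=> /(_ mind); move: T2; rewrite !inE => /orP[]/eqP->; case/orP=> /eqP; lia.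
Qed.

Lemma proper_adjacent : (1 <= L) -> proper_coloring -> adjacent_distinct.
Proof. by move=> L1 pr x g h e; apply: h; apply: (pr x [:: g]). Qed.

Lemma proper_transported : proper_coloring -> transported.
Proof. by move=> pr x u h lu lh e; rewrite /view actl_cat (pr x u). Qed.

(** With a proper colouring, a view that looks simple and closed comes from a simple closed curve,
    which turns by [+-2]. *)
Lemma proper_cycles_turn : proper_coloring -> cycles_turn.
Proof.
move=> pr x u leL /and4P[n2 g01 /eqP ecol un].
have ret : actl w u x = x by apply: pr.
pose y := walk w (cyc_gen u) x.
have yn : y (size u) = x by rewrite /y walk_size.
have labper t : lab (y (size u + t)) = lab (y t).
  congr lab; symmetry; apply: (@walk_inj _ w (cyc_gen u) x 0 (size u)) => [i|//].
  by have := cyc_gen_add u 1 i; rewrite mul1n => ->.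
have colinj s t : (s < size u) -> (t < size u) ->
    col (lab (y s)) = col (lab (y t)) -> s = t.
  move=> ls lt; rewrite /y !walk_take ?(ltnW ls) ?(ltnW lt) // => e.
  apply/eqP.
  have := nth_uniq (col (lab x)) _ _ un; rewrite size_map size_iota => /(_ s t ls lt).
  by rewrite !(nth_map 0%N) ?size_iota // !nth_iota // !add0n /view e eqxx => <-.
(* A curve of two steps is too short for [sum_turning_closed]. It consists of two neighbours joined
   by the line and by an arc, and each of its two vertices turns by the bend of the arc. *)
have [u2|n3] := leqP (size u) 2; last first.
  rewrite -[view_turning _ _]mul1r.
  apply: (closed_walk_turning n2 labper colinj (k := 1) _ n3 yn); first by rewrite mul1n.
  move=> d /andP[d0 dn] e; have := colinj d 0%N dn.
    by rewrite /y e => /(_ (ltnW n2) erefl) d00; lia.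
have y01 : x <> act w (cyc_gen u 0) x by exact: (@walk_succ x u n2 labper colinj 0).
case: u {leL un ecol y yn labper colinj} n2 g01 ret u2 y01 => [//|g [//|g' [|//]]] _ /= g01.
rewrite /actl /= => ret _ y01.
rewrite /view_turning /= big_nat_recr //= big_nat_recr //= big_geq // add0r.
rewrite /view /actl /= ret /cyc_gen !modnn /= !symE !parE.
rewrite /cyc_gen /= in g01 y01.
have y10 : act w g' (act w g x) <> act w g x by rewrite ret.
have hd : heading x (act w g x) = step_heading (w x) (odd x) g.
  by apply: heading_act => e; apply: y01.
have := heading_act y10; rewrite ret => hd'.
rewrite /vertex_turning -hd -hd'.
have hneq : (heading x (act w g x) == heading (act w g x) x) = false.
  by rewrite /heading; move: y01; move: (act w g x) => z; case: ltngtP => // ->.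
rewrite hneq eq_sym hneq.
have bend z : act w None z <> z -> step_bend (w z) None = 1%R \/ step_bend (w z) None = (-1)%R.
  move=> nz; rewrite bend_act // /side_sign /step_heading.
  by case: ifP; case: kind_of => *; rewrite ?mul1r ?mulN1r ?opprK; auto.
case: g g01 ret y01 y10 {hd hd' hneq} => [b|]; case: g' => [b'|] g01 ret y01 y10.
- exfalso; move: ret y01 g01; rewrite /act.
  case: b {y10}; case: b' => //=;
    case ox : (odd x) => /=; rewrite ?ox /=; case: x ox => [|x] //=; try lia;
    case: (odd x) => //=; lia.
- rewrite [step_bend (w x) _]/= !add0r !addr0.
  by have [->|->] := bend _ y10; rewrite !inE.
- rewrite [step_bend (w (act _ _ _)) _]/= !add0r !addr0.
  by have [->|->] := bend _ (nesym y01); rewrite !inE.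
- by [].
Qed.
End View.

(** * Locality of the logic with infinity quantifier *)

Definition words (r : nat) : seq (seq (option bool)) :=
  [seq bseqval u | u <- enum {: r.-bseq (option bool)}].

Lemma mem_words r u : (u \in words r) = (size u <= r).
Proof.
apply/mapP/idP => [[v _ ->]|ur]; first exact: size_bseq.
by exists (Bseq ur) => //; rewrite mem_enum.
Qed.

(** * Colourings that separate nearby positions *)

Section GreedyColouring.
Variables (K : nat) (nbr : nat -> seq nat).
Hypothesis nbr_size : forall x, size (nbr x) <= K.

Fixpoint greedy (n : nat) : seq 'I_K.+1 :=
  if n is m.+1 then
    rcons (greedy m)
      (odflt ord0 [pick k | k \notin [seq nth ord0 (greedy m) x | x <- nbr m]])
  else [::].

Lemma size_greedy n : size (greedy n) = n.
Proof. by elim: n => //= n IH; rewrite size_rcons IH. Qed.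

Lemma nth_greedy n m x : x < n -> n <= m -> nth ord0 (greedy m) x = nth ord0 (greedy n) x.
Proof.
move=> xn /subnKC <-; elim: (m - n) => [|d IH]; first by rewrite addn0.
by rewrite addnS /= nth_rcons size_greedy ifT //; lia.
Qed.

(** Each position in turn avoids at most [K] colours. For list entries not yet coloured the default
    [ord0] is avoided, which keeps the count. *)
Lemma greedy_colouring : exists c : nat -> 'I_K.+1,
  forall x y, y \in nbr x -> y < x -> c y <> c x.
Proof.
exists (fun x => nth ord0 (greedy x.+1) x) => x y yx lt.
rewrite [in RHS]/= nth_rcons size_greedy ltnn eqxx.
rewrite -(@nth_greedy y.+1 x) //.
case: pickP => [k /negP nk|nopick] /= e.
  by apply: nk; rewrite -e; apply: map_f.
have : #|'I_K.+1| <= #|[seq nth ord0 (greedy x) z | z <- nbr x]|.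
  by apply/subset_leq_card/fintype.subsetP => k _; have := nopick k => /= /negbFE.
move=> /leq_trans/(_ (card_size _)); rewrite size_map card_ord => h.
by have := nbr_size x; lia.
Qed.
End GreedyColouring.

Lemma proper_colouring_exists (S : alphabet) (w : word S) L :
  exists c : nat -> 'I_(size (words L)).+1,
    forall x u, size u <= L -> c (actl w u x) = c x -> actl w u x = x.
Proof.
have [//|c cP] := @greedy_colouring (size (words L)) (fun x => [seq actl w u x | u <- words L]).
  by move=> x; rewrite size_map.
exists c => x u ur e; have [lt|gt|//] := ltngtP (actl w u x) x.
  by case: (cP x (actl w u x)) => //; apply/mapP; exists u; rewrite ?mem_words.
(* The reversed walk leads back, so the right one of the two positions may always be taken as the
   one coloured later. *)
case: (cP (actl w u x) x) => //; apply/mapP; exists (rev u).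
  by rewrite mem_words size_rev.
by rewrite actl_revK.
Qed.

Definition at_least (P : pred nat) (n : nat) : Prop :=
  exists s : seq nat, [/\ uniq s, size s = n & all P s].

(** * Ball types and the Ehrenfeucht-Fraisse argument *)

Section Models.
Variables (S : alphabet) (T : finType).
Variables (sym : T -> S) (par : T -> bool) (bit : nat -> T -> bool).

(* A word together with a valuation of the set variables, both of them read
   off one labelling. *)
Record model := Model {
  mword : word S;
  mlab : nat -> T;
  msym : forall x, sym (mlab x) = mword x;
  mpar : forall x, par (mlab x) = odd x
}.

Definition msat (M : model) (e : nat -> nat) (p : mso S) : Prop :=
  sat (nested (mword M)) e (fun X => [set x | bit X (mlab M x)]%classic) p.

(** The isomorphism type of a ball of radius [r]: the labels at the ends of all short walks, and
    which of these walks have the same end. *)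
Definition ball (r : nat) : finType :=
  ({ffun r.-bseq (option bool) -> T}
   * {ffun r.-bseq (option bool) * r.-bseq (option bool) -> bool})%type.

Definition ball_at r (M : model) (x : nat) : ball r :=
  ([ffun u : r.-bseq _ => mlab M (actl (mword M) u x)],
   [ffun uv : r.-bseq _ * r.-bseq _ =>
      actl (mword M) uv.1 x == actl (mword M) uv.2 x]).

Lemma ball_atP r M x M' x' : ball_at r M x = ball_at r M' x' ->
  (forall u, size u <= r ->
     mlab M (actl (mword M) u x) = mlab M' (actl (mword M') u x'))
  /\ (forall u v, size u <= r -> size v <= r ->
     (actl (mword M) u x == actl (mword M) v x)
     = (actl (mword M') u x' == actl (mword M') v x')).
Proof.
case=> /ffunP e1 /ffunP e2; split=> [u ur|u v ur vr].
  by have := e1 (Bseq ur); rewrite !ffunE.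
by have := e2 (Bseq ur, Bseq vr); rewrite !ffunE.
Qed.

Lemma eq_ball_at r M x M' x' :
  (forall u, size u <= r ->
     mlab M (actl (mword M) u x) = mlab M' (actl (mword M') u x')) ->
  (forall u v, size u <= r -> size v <= r ->
     (actl (mword M) u x == actl (mword M) v x)
     = (actl (mword M') u x' == actl (mword M') v x')) ->
  ball_at r M x = ball_at r M' x'.
Proof.
move=> h1 h2; congr pair; apply/ffunP => u; rewrite !ffunE.
  by apply: h1; apply: size_bseq.
by apply: h2; apply: size_bseq.
Qed.

Definition ball_simulated (R t : nat) (M M' : model) : Prop :=
  forall r (b : ball r), r <= R ->
    (forall n, n <= t -> at_least (fun x => ball_at r M x == b) n ->
       at_least (fun x => ball_at r M' x == b) n)
    /\ (infinitely_often (fun m => ball_at r M m = b) ->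
        infinitely_often (fun m => ball_at r M' m = b)).

Lemma ball_simulatedS R t R' t' M M' : R' <= R -> t' <= t ->
  ball_simulated R t M M' -> ball_simulated R' t' M M'.
Proof.
move=> RR tt h r b rR; have [h1 h2] := h r b (leq_trans rR RR).
by split=> // n nt; apply: h1; apply: leq_trans tt.
Qed.

Definition local_iso (r : nat) (V : seq nat) M (e : nat -> nat) M' (e' : nat -> nat) : Prop :=
  (forall i u, i \in V -> size u <= r ->
     mlab M (actl (mword M) u (e i)) = mlab M' (actl (mword M') u (e' i)))
  /\ (forall i j u v, i \in V -> j \in V -> size u <= r -> size v <= r ->
     (actl (mword M) u (e i) == actl (mword M) v (e j))
     = (actl (mword M') u (e' i) == actl (mword M') v (e' j))).

Lemma local_isoS r r' V V' M e M' e' : r' <= r -> {subset V' <= V} ->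
  local_iso r V M e M' e' -> local_iso r' V' M e M' e'.
Proof.
move=> rr VV [h1 h2]; split=> [i u /VV iV ur|i j u v /VV iV /VV jV ur vr].
  by apply: h1 => //; apply: leq_trans rr.
by apply: h2 => //; apply: leq_trans rr.
Qed.

Lemma local_iso_sym r V M e M' e' :
  local_iso r V M e M' e' -> local_iso r V M' e' M e.
Proof.
by case=> h1 h2; split=> [i u iV ur|i j u v iV jV ur vr]; [rewrite h1|rewrite h2].
Qed.

Lemma local_iso_upd r V M e M' e' x c d :
  local_iso r V M e M' e' -> ball_at r M c = ball_at r M' d ->
  (forall i u v, i \in V -> size u <= r -> size v <= r ->
     (actl (mword M) u c == actl (mword M) v (e i))
     = (actl (mword M') u d == actl (mword M') v (e' i))) ->
  local_iso r (x :: V) M (upd e x c) M' (upd e' x d).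
Proof.
move=> [h1 h2] /ball_atP[b1 b2] h3; split=> [i u|i j u v].
  rewrite inE /upd => /orP[->|iV] ur; first exact: b1.
  by case: ifP => _; [apply: b1|apply: h1].
have V' k : k \in x :: V -> k != x -> k \in V.
  by rewrite inE => /orP[->|].
move=> /V' iV /V' jV ur vr; rewrite /upd.
case: (altP (i =P x)) iV => [_ _|ix /(_ isT) iV];
  case: (altP (j =P x)) jV => [_ _|jx /(_ isT) jV].
- exact: b2.
- exact: h3.
- by rewrite eq_sym h3 // eq_sym.
- exact: h2.
Qed.

Definition near r (V : seq nat) M (e : nat -> nat) : seq nat :=
  [seq actl (mword M) iu.2 (e iu.1) | iu <- [seq (i, u) | i <- V, u <- words r]].

Lemma nearP r V M e c :
  reflect (exists i u, [/\ i \in V, size u <= r & c = actl (mword M) u (e i)])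
          (c \in near r V M e).
Proof.
apply: (iffP mapP) => [[[i u] /allpairsP[[j v] /= [jV vr [-> ->]]] ->]|].
  by exists j, v; rewrite -mem_words.
move=> [i [u [iV ur ->]]]; exists (i, u) => //.
by apply/allpairsP; exists (i, u); rewrite mem_words.
Qed.

Lemma actl_far r V M e c u v i : c \notin near (r + r) V M e ->
  i \in V -> size u <= r -> size v <= r ->
  (actl (mword M) u c == actl (mword M) v (e i)) = false.
Proof.
move=> /nearP cn iV ur vr; apply/negP => /eqP h; apply: cn.
exists i, (v ++ rev u); split=> //; first by rewrite size_cat size_rev leq_add.
by rewrite actl_cat -h actl_revK.
Qed.

Lemma local_iso_far r V M e M' e' x c d :
  local_iso r V M e M' e' -> ball_at r M c = ball_at r M' d ->
  c \notin near (r + r) V M e -> d \notin near (r + r) V M' e' ->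
  local_iso r (x :: V) M (upd e x c) M' (upd e' x d).
Proof.
move=> li b cn dn; apply: local_iso_upd => // i u v iV ur vr.
by rewrite (actl_far cn) ?(actl_far dn).
Qed.

(** The same walk from the same parameter is taken in both models; the ball around its end stays
    within [r + r + r] of that parameter. *)
Lemma local_iso_near r V M e M' e' x i u :
  local_iso (r + r + r) V M e M' e' -> i \in V -> size u <= r + r ->
  local_iso r (x :: V) M (upd e x (actl (mword M) u (e i)))
                       M' (upd e' x (actl (mword M') u (e' i))).
Proof.
move=> [h1 h2] iV ur.
have sz v : size v <= r -> size (u ++ v) <= r + r + r.
  by move=> vr; rewrite size_cat leq_add.
apply: local_iso_upd.
- by apply: local_isoS (conj h1 h2) => //; rewrite -addnA leq_addr.
- apply: eq_ball_at => [v vr|v v' vr vr']; rewrite -!actl_cat.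
    by apply: h1 => //; apply: sz.
  by apply: h2 => //; apply: sz.
- move=> j v v' jV vr vr'; rewrite -!actl_cat; apply: h2 => //; first exact: sz.
  by lia.
Qed.

Lemma subset_map_exists (A B : eqType) (f : A -> B) (ks : seq A) (t : seq B) :
  {subset t <= map f ks} -> exists2 K, {subset K <= ks} & map f K = t.
Proof.
elim: t => [|b t IH] h; first by exists [::].
have [|K Kks <-] := IH; first by move=> z zt; apply: h; rewrite inE zt orbT.
have /mapP[a aks eb] : b \in map f ks by apply: h; rewrite mem_head.
exists (a :: K); last by rewrite /= eb.
by move=> z; rewrite inE => /orP[/eqP->|/Kks].
Qed.

(* A far point of some ball type in [M] gives one in [M']: in both models the
   points of this type near the parameters are equally many. *)
Lemma far_exists r t V M e M' e' c :
  local_iso (r + r + r) V M e M' e' -> ball_simulated r t M M' ->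
  size V * size (words (r + r)) < t -> c \notin near (r + r) V M e ->
  exists2 d, d \notin near (r + r) V M' e' & ball_at r M c = ball_at r M' d.
Proof.
move=> [h1 h2] sim lt cn.
set ks := [seq (i, u) | i <- V, u <- words (r + r)].
pose f (iu : nat * seq (option bool)) := actl (mword M) iu.2 (e iu.1).
pose f' (iu : nat * seq (option bool)) := actl (mword M') iu.2 (e' iu.1).
have ksP k : k \in ks -> k.1 \in V /\ size k.2 <= r + r.
  by move=> /allpairsP[[j v] /= [jV vr ->]]; rewrite -mem_words.
have rrr : r + r <= r + r + r by rewrite leq_addr.
(* The points near the parameters of [M'] with the ball type of [c]. Each is reached by a walk in
   [K], and these walks have distinct ends in [M] too. *)
pose t' := undup [seq z <- near (r + r) V M' e' | ball_at r M' z == ball_at r M c].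
have [|K Kks eK] := @subset_map_exists _ _ f' ks t'.
  by move=> z; rewrite mem_undup mem_filter => /andP[].
have Kf : uniq (map f K).
  have : uniq (map f' K) by rewrite eK undup_uniq.
  have iK : {in K &, forall k l, (f k == f l) = (f' k == f' l)}.
    move=> k l /Kks/ksP[k1 k2] /Kks/ksP[l1 l2]; apply: h2 => //.
      exact: leq_trans rrr.
    exact: leq_trans rrr.
  elim: (K) iK => [//|k K' IH] iK /= /andP[kK uK]; apply/andP; split; last first.
    by apply: IH => // a b aK bK; apply: iK; rewrite inE ?aK ?bK orbT.
  apply: contra kK => /mapP[l lK /eqP]; rewrite iK ?mem_head //; last by rewrite inE lK orbT.
  by move=> /eqP->; apply: map_f.
have szK : size K <= size V * size (words (r + r)).
  have -> : size K = size t' by rewrite -eK size_map.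
  apply: leq_trans (size_undup _) _; rewrite size_filter.
  by apply: leq_trans (count_size _ _) _; rewrite size_map size_allpairs.
(* With the far point [c], the model [M] has one point of this type more than [M'] has near its
   parameters. *)
have al : at_least (fun x => ball_at r M x == ball_at r M c) (size K).+1.
  exists (c :: map f K); rewrite /= size_map Kf andbT; split=> //.
    apply: contra cn => /mapP[k kK ->]; have [k1 k2] := ksP _ (Kks _ kK).
    by apply/nearP; exists k.1, k.2.
  rewrite eqxx /=; apply/allP => _ /mapP[k kK ->].
  have [k1 k2] := ksP _ (Kks _ kK).
  have : f' k \in t' by rewrite -eK; apply: map_f.
  rewrite mem_undup mem_filter => /andP[/eqP <- _]; apply/eqP.
  apply: eq_ball_at => [u ur|u v ur vr]; rewrite -!actl_cat.
    by apply: h1 => //; rewrite size_cat leq_add.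
  by apply: h2 => //; rewrite size_cat leq_add.
have [h _] := sim r (ball_at r M c) (leqnn r).
have [|s [us ss as_]] := h _ _ al; first by apply: leq_ltn_trans lt.
have [d ds dt] : exists2 d, d \in s & d \notin t'.
  apply: contrapT => nd; have : {subset s <= t'}.
    by move=> d ds; apply: contrapT => /negP dt; apply: nd; exists d.
  by move=> /(uniq_leq_size us); rewrite ss -eK size_map ltnn.
have /eqP ed := allP as_ _ ds; exists d => //.
apply: contra dt => dn; rewrite mem_undup mem_filter dn andbT.
by rewrite ed.
Qed.

Lemma infinitely_often_notin (P : nat -> Prop) (s : seq nat) :
  infinitely_often P -> infinitely_often (fun m => P m /\ m \notin s).
Proof.
move=> Pio n; have [m] := Pio (maxn n (\max_(i <- s) i).+1).
rewrite geq_max => /andP[nm sm] Pm; exists m => //; split=> //.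
apply/negP => /(@leq_bigmax_seq _ _ predT id)/(_ isT) /=.
by rewrite leqNgt sm.
Qed.

Lemma mu_act M i j : mu (nested (mword M)) (i, j) <->
  [/\ [exists s, is_call s (sym (mlab M i))], actl (mword M) [:: None] i = j & i <> j].
Proof.
rewrite msym; split.
  move=> ij; have [s [_ cs _ _]] := (mu_ofP _ _ _).1 ij; split.
  - by apply/existsP; exists s.
  - by rewrite /actl /=; apply: partnerE; left.
  - by have := mu_lt ij; lia.
case=> /existsP[s cs]; rewrite /actl /= => <- ne.
have [//|mu] : linked (mword M) i (partner (mword M) i).
  by apply/partner_linked/partner_neq/nesym.
have [s' [_ _ rs' _]] := (mu_ofP _ _ _).1 mu.
by case: (call_ret_excl cs rs').
Qed.

Lemma succ_act M i j : j = i.+1 <-> actl (mword M) [:: Some (par (mlab M i))] i = j.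
Proof. by rewrite mpar /actl /= eqxx; split=> ->. Qed.

End Models.

(** Induction on [p]; a quantifier triples the radius, and [MEx] also raises the threshold above the
    number of points near the parameters. Negation exchanges the two models. [R] and [t] come before
    [T], as the colours in the labelling will depend on [R]. *)
Theorem msat_local (S : alphabet) (p : mso S) : no_set_quantifier p ->
  forall V, {subset free1 p <= V} -> exists R t,
  forall (T : finType) (sym : T -> S) (par : T -> bool) (bit : nat -> T -> bool)
    (M M' : model sym par) e e',
    ball_simulated R t M M' -> ball_simulated R t M' M ->
    local_iso R V M e M' e' -> msat bit M e p -> msat bit M' e' p.
Proof.
elim: p => [x a|x y|x y|x y|x X|p IH|p IHp q IHq|x p IH|x p IH|//] /= nq V fV.
- exists 0, 0 => T sym par bit M M' e e' _ _ [h _]; rewrite /msat /= => <-.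
  have := h x [::]; rewrite /actl /= -!msym => -> //; apply: fV; exact: mem_head.
- exists 1, 0 => T sym par bit M M' e e' _ _ [h h'].
  have xV : x \in V by apply: fV; rewrite mem_head.
  have yV : y \in V by apply: fV; rewrite !inE eqxx orbT.
  have elab : mlab M (e x) = mlab M' (e' x) by exact: (h x [::]).
  move=> /(succ_act M) /eqP E; apply/(succ_act M')/eqP.
  have := h' x y [:: Some (par (mlab M' (e' x)))] [::] xV yV isT isT.
  by rewrite -[X in actl _ X _ == actl _ [::] (e y)]/[:: Some _] -elab => <-.
- exists 1, 0 => T sym par bit M M' e e' _ _ [h h'].
  have xV : x \in V by apply: fV; rewrite mem_head.
  have yV : y \in V by apply: fV; rewrite !inE eqxx orbT.
  have elab : mlab M (e x) = mlab M' (e' x) by exact: (h x [::]).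
  move=> /mu_act[c /eqP a n]; apply/mu_act; split.
  + by rewrite -elab.
  + by apply/eqP; have := h' x y [:: None] [::] xV yV isT isT => <-.
  + by move=> /eqP exy; apply: n; apply/eqP; have := h' x y [::] [::] xV yV isT isT => ->.
- exists 0, 0 => T sym par bit M M' e e' _ _ [_ h'] /eqP exy.
  have xV : x \in V by apply: fV; rewrite mem_head.
  have yV : y \in V by apply: fV; rewrite !inE eqxx orbT.
  by apply/eqP; have := h' x y [::] [::] xV yV isT isT => <-.
- exists 0, 0 => T sym par bit M M' e e' _ _ [h _]; rewrite /msat /=.
  by have := h x [::] (fV _ (mem_head _ _)) isT; rewrite /actl /= => ->.
- have [R [t IHR]] := IH nq V fV; exists R, t => T sym par bit M M' e e' s1 s2 li np p'.
  by apply: np; apply: IHR p' => //; apply: local_iso_sym.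
- move/andP: nq => [nqp nqq].
  have [|R1 [t1 IH1]] := IHp nqp V; first by move=> i ip; apply: fV; rewrite mem_cat ip.
  have [|R2 [t2 IH2]] := IHq nqq V; first by move=> i ip; apply: fV; rewrite mem_cat ip orbT.
  exists (maxn R1 R2), (maxn t1 t2) => T sym par bit M M' e e' s1 s2 li [h|h]; [left|right].
    apply: IH1 h; [apply: ball_simulatedS s1|apply: ball_simulatedS s2|apply: local_isoS li];
      by rewrite ?leq_maxl.
  apply: IH2 h; [apply: ball_simulatedS s1|apply: ball_simulatedS s2|apply: local_isoS li];
    by rewrite ?leq_maxr.
- have [|r [t IHr]] := IH nq (x :: V).
    by move=> i ip; rewrite inE; case: eqP => //= /eqP ix; apply: fV; rewrite mem_filter ix.
  exists (r + r + r), (maxn t (size V * size (words (r + r))).+1).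
  move=> T sym par bit M M' e e' s1 s2 li [c pc].
  have rr : r <= r + r + r by lia.
  have IH' d : local_iso r (x :: V) M (upd e x c) M' (upd e' x d) -> msat bit M' (upd e' x d) p.
    move=> li'; apply: IHr li' pc; [apply: ball_simulatedS s1|apply: ball_simulatedS s2];
      by rewrite ?leq_maxl.
  have [/nearP[i [u [iV ur ec]]]|cn] := boolP (c \in near (r + r) V M e).
    by exists (actl (mword M') u (e' i)); apply: IH'; rewrite ec; apply: local_iso_near.
  have lt : size V * size (words (r + r)) < maxn t (size V * size (words (r + r))).+1.
    by rewrite leq_max leqnn orbT.
  have [d dn b] := far_exists li (ball_simulatedS rr (leqnn _) s1) lt cn.
  by exists d; apply: IH'; apply: local_iso_far => //; apply: local_isoS li.
- have [|r [t IHr]] := IH nq (x :: V).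
    by move=> i ip; rewrite inE; case: eqP => //= /eqP ix; apply: fV; rewrite mem_filter ix.
  exists (r + r + r), t => T sym par bit M M' e e' s1 s2 li.
  have rr : r <= r + r + r by lia.
  move=> /infinite_setP /(@infinitely_often_notin _ (near (r + r) V M e)) inf.
  (* Only finitely many witnesses are near the parameters. Among the others one ball type occurs
     infinitely often, hence also in [M'], where every far point of this type is a witness. *)
  have [b bio] := infinitely_often_pigeonhole (ball_at r M) inf.
  have [c _ [[pc cn] bc]] := bio 0.
  have bio' n : exists2 m, n <= m & ball_at r M m = b.
    by have [m nm [_ bm]] := bio n; exists m.
  have [_ /(_ bio')] := s1 r b rr.
  move=> /(@infinitely_often_notin _ (near (r + r) V M' e')) inf'.
  apply/infinite_setP => n; have [d nd [bd dn]] := inf' n; exists d => //.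
  have li' : local_iso r (x :: V) M (upd e x c) M' (upd e' x d).
    by apply: local_iso_far => //; [apply: local_isoS li|rewrite bc bd].
  by apply: IHr li' pc; [apply: ball_simulatedS s1|apply: ball_simulatedS s2].
Qed.

(** * Tilings are recognised by automata *)

Section Seen.
Variables (J : finType) (seen hit : nat -> {set J}).
Hypothesis seenS : forall i,
  seen i.+1 = if seen i == [set: J] then hit i else seen i :|: hit i.

(** The usual reduction of several acceptance conditions to one. Between two full moments every
    condition is met; conversely, without a reset [seen] only grows and becomes full. *)
Lemma seen_full_often :
  infinitely_often (fun i => seen i = [set: J]) <->
  (forall j, infinitely_often (fun i => j \in hit i)).
Proof.
split=> [full j n|often n].
  have [a na fa] := full n; have [b ab fb] := full a.+1.
  have hits d : j \in seen (a + d.+1) -> exists2 m, n <= m & j \in hit m.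
    elim: d => [|d IH]; first by rewrite addn1 seenS fa eqxx => ja; exists a.
    rewrite addnS seenS; case: ifP => _ jd; first by exists (a + d.+1) => //; lia.
    by move: jd; rewrite inE => /orP[/IH//|jd]; exists (a + d.+1) => //; lia.
  by apply: (hits (b - a.+1)); rewrite (_ : _ + _ = b) ?fb ?inE //; lia.
apply: contrapT => nofull.
have {}nofull i : n <= i -> seen i == [set: J] = false.
  by move=> ni; apply/negP => /eqP si; apply: nofull; exists i.
have mono i d : n <= i -> seen i \subset seen (i + d).
  move=> ni; elim: d => [|d IH]; first by rewrite addn0.
  rewrite addnS seenS nofull; last by lia.
  by apply: fintype.subset_trans IH _; apply: finset.subsetUl.
have /choice[m mP] j : exists m, n <= m /\ j \in hit m.
  by have [m nm jm] := often j n; exists m.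
have := nofull (n + \max_j (m j).+1) (leq_addr _ _).
move=> /negP; apply; apply/eqP/finset.setP => j; rewrite inE.
have [nm jm] := mP j; have mS : n <= (m j).+1 by lia.
have le : (m j).+1 <= n + \max_j (m j).+1.
  by apply: leq_trans (leq_addl _ _); apply: (@leq_bigmax _ (fun j => (m j).+1)).
have /fintype.subsetP := mono _ (n + \max_j (m j).+1 - (m j).+1) mS.
rewrite subnKC //; apply.
by rewrite seenS nofull // inE jm orbT.
Qed.
End Seen.

Section Tilings.
Variables (S : alphabet) (Lab J : finType).
Variables (init : pred Lab) (loc : rel Lab) (lett : S -> pred Lab)
  (mat : rel Lab) (mt : pred Lab) (acc : J -> pred Lab).

Definition tiling (w : word S) (l : nat -> Lab) : Prop :=
  [/\ init (l 0), forall i, loc (l i) (l i.+1) /\ lett (w i) (l i),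
      forall i j, mu_of w (i, j) -> mat (l i) (l j),
      forall i, mt (l i) <-> matched w i
    & forall j, infinitely_often (fun i => acc j (l i))].

(* A state records the previous label, for each stack whether its top claims
   to be a matched call, and the acceptance conditions met recently. The claims
   are correct if each stack has infinitely often a top that is not claimed
   matched, as claims are inherited upwards. *)
Definition tstate : finType :=
  (option Lab * {ffun 'I_2 -> bool} * {set J + 'I_2})%type.
(** [None] is the bottom. A pair holds the label of the call and the claim about the entry below,
    which is restored when the call is popped. *)
Definition tsym : finType := option (Lab * bool).

Definition hits (l : Lab) (tp : {ffun 'I_2 -> bool}) : {set J + 'I_2} :=
  [set j | match j with inl j => acc j l | inr s => ~~ tp s end].

Definition core (q : tstate) (a : S) (q' : tstate) : bool :=
  if q'.1.1 is Some l then
    [&& lett a l, (if q.1.1 is Some l0 then loc l0 l else init l)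
      & q'.2 == if q.2 == [set: J + 'I_2] then hits l q'.1.2 else q.2 :|: hits l q'.1.2]
  else false.

Definition set_top (s : 'I_2) (b : bool) (tp : {ffun 'I_2 -> bool}) : {ffun 'I_2 -> bool} :=
  [ffun t => if t == s then b else tp t].

(** The condition [b ==> mt l] is the inheritance of claims: above a call claimed matched, a new
    call must be claimed matched. *)
Definition call_ok (s : 'I_2) (q : tstate) (X : tsym) (q' : tstate) : bool :=
  if (X, q'.1.1) is (Some (l0, b), Some l) then
    [&& l0 == l, b == q.1.2 s, b ==> mt l & q'.1.2 == set_top s (mt l) q.1.2]
  else false.

Definition ret_ok (s : 'I_2) (q : tstate) (X : tsym) (q' : tstate) : bool :=
  if q'.1.1 is Some l then
    if X is Some (l0, b) then
      [&& mt l0, mt l, mat l0 l & q'.1.2 == set_top s b q.1.2]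
    else ~~ mt l && (q'.1.2 == q.1.2)
  else false.

Definition int_ok (q q' : tstate) : bool :=
  if q'.1.1 is Some l then ~~ mt l && (q'.1.2 == q.1.2) else false.

Definition tcall : {set tstate * S * tsym * tstate} :=
  [set x | core x.1.1.1 x.1.1.2 x.2 &&
           [exists s, is_call s x.1.1.2 && call_ok s x.1.1.1 x.1.2 x.2]].
Definition tret : {set tstate * S * tsym * tstate} :=
  [set x | core x.1.1.1 x.1.1.2 x.2 &&
           [exists s, is_ret s x.1.1.2 && ret_ok s x.1.1.1 x.1.2 x.2]].
Definition tint : {set tstate * S * tstate} :=
  [set x | [&& core x.1.1 x.1.2 x.2, is_internal x.1.2 & int_ok x.1.1 x.2]].

Lemma tcall_ok s q a X q' : is_call s a -> (q, a, X, q') \in tcall -> call_ok s q X q'.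
Proof.
move=> c; rewrite inE => /andP[_ /existsP[s' /andP[c' ok]]].
by rewrite (is_call_inj c c').
Qed.

Lemma tret_ok s q a X q' : is_ret s a -> (q, a, X, q') \in tret -> ret_ok s q X q'.
Proof.
move=> r; rewrite inE => /andP[_ /existsP[s' /andP[r' ok]]].
by rewrite (is_ret_inj r r').
Qed.

Lemma tcall_sub q a X q' : (q, a, X, q') \in tcall ->
  [exists s, is_call s a] && (X != None).
Proof.
rewrite inE /= => /andP[_ /existsP[s /andP[cs ok]]]; apply/andP; split.
  by apply/existsP; exists s.
by case: X ok.
Qed.

Lemma tret_sub q a X q' : (q, a, X, q') \in tret -> [exists s, is_ret s a].
Proof. by rewrite inE /= => /andP[_ /existsP[s /andP[rs _]]]; apply/existsP; exists s. Qed.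

Lemma tint_sub q a q' : (q, a, q') \in tint -> is_internal a.
Proof. by rewrite inE /= => /and3P[]. Qed.

Definition tiling_vpa : vpa S :=
  @VPA S tstate tsym None tcall tret tint
    [set (None, [ffun=> false], finset.set0)] [set q | q.2 == [set: J + 'I_2]]
    tcall_sub tret_sub tint_sub.

Section Encode.
Variables (w : word S) (l : nat -> Lab).

Definition claim (u : seq nat) : bool := if u is i :: _ then mt (l i) else false.

Fixpoint enc (u : seq nat) : seq tsym :=
  if u is i :: v then Some (l i, claim v) :: enc v else [:: None].

Lemma enc_rcons u : exists2 v, None \notin v & enc u = rcons v None.
Proof.
elim: u => [|i u [v nv e]] /=; first by exists [::].
by exists (Some (l i, claim u) :: v); rewrite ?inE //= e.
Qed.

Definition tops (i : nat) : {ffun 'I_2 -> bool} := [ffun s => claim (pend w s i)].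

Fixpoint seen (i : nat) : {set J + 'I_2} :=
  if i is k.+1 then
    if seen k == [set: _] then hits (l k) (tops k.+1)
    else seen k :|: hits (l k) (tops k.+1)
  else finset.set0.

Definition trun (i : nat) : config tiling_vpa :=
  @Config _ tiling_vpa (if i is k.+1 then Some (l k) else None, tops i, seen i)
    (fun s => enc (pend w s i)).

Lemma tops_other s i : ~~ is_call s (w i) -> ~~ is_ret s (w i) -> tops i.+1 s = tops i s.
Proof. by move=> nc nr; rewrite !ffunE pend_other. Qed.

Lemma callN s t (a : S) : is_call s a -> t != s -> ~~ is_call t a /\ ~~ is_ret t a.
Proof.
rewrite /is_call /is_ret; case: kind_of => // s' /eqP<- ts; split=> //.
by rewrite eq_sym.
Qed.

Lemma retN s t (a : S) : is_ret s a -> t != s -> ~~ is_call t a /\ ~~ is_ret t a.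
Proof.
rewrite /is_call /is_ret; case: kind_of => // s' /eqP<- ts; split=> //.
by rewrite eq_sym.
Qed.

Lemma intN t (a : S) : is_internal a -> ~~ is_call t a /\ ~~ is_ret t a.
Proof. by rewrite /is_internal /is_call /is_ret; case: kind_of. Qed.

Lemma tops_call s i : is_call s (w i) -> tops i.+1 = set_top s (mt (l i)) (tops i).
Proof.
move=> c; apply/ffunP => t; rewrite [RHS]ffunE; case: eqP => [->|/eqP ts].
  by rewrite ffunE pend_call.
by have [] := callN c ts; apply: tops_other.
Qed.

Lemma tops_ret s i : is_ret s (w i) ->
  tops i.+1 = set_top s (claim (behead (pend w s i))) (tops i).
Proof.
move=> c; apply/ffunP => t; rewrite [RHS]ffunE; case: eqP => [->|/eqP ts].
  by rewrite ffunE pend_ret.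
by have [] := retN c ts; apply: tops_other.
Qed.

Lemma tops_int i : is_internal (w i) -> tops i.+1 = tops i.
Proof. by move=> c; apply/ffunP => t; have [] := intN t c; apply: tops_other. Qed.

Lemma matched_kind i : matched w i -> ~ is_internal (w i).
Proof.
move=> [j [/mu_ofP[s n]|/mu_ofP[s n]]] /(intN s)[nc nr]; have [c r] := nesting_kind n.
  by rewrite c in nc.
by rewrite r in nr.
Qed.

Hypothesis til : tiling w l.

Lemma trun_core i : core (cstate (trun i)) (w i) (cstate (trun i.+1)).
Proof.
have [h0 hl _ _ _] := til; rewrite /core /= (hl i).2 eqxx andbT /=.
by case: i => [|i]; [exact: h0|exact: (hl i).1].
Qed.

Lemma trun_step i : step (w i) (trun i) (trun i.+1).
Proof.
have [h0 hl hm hmt _] := til; have co := trun_core i.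
rewrite /step; case k: (kind_of (w i)) => [s|s|].
- have c : is_call s (w i) by rewrite /is_call k eqxx.
  exists (Some (l i, claim (pend w s i))); split.
  + rewrite inE co /=; apply/existsP; exists s; rewrite c /call_ok /=.
    rewrite !eqxx /= (tops_call c) eqxx andbT ffunE eqxx /=; apply/implyP.
    case e: (pend w s i) => [//|j u] /= mj; apply/hmt.
    by apply: (matched_above e) => //; apply/hmt.
  + by rewrite [cstack _ _]/= c.
  + by move=> t ts; have [nc nr] := callN c ts; exact: congr1 (pend_other nc nr).
- have r : is_ret s (w i) by rewrite /is_ret k eqxx.
  have nc : is_call s (w i) = false by rewrite /is_call k.
  have tr := tops_ret r; have mr := matched_ret r.
  have other : same_stacks_but s (trun i) (trun i.+1).
    by move=> t ts; have [nc' nr'] := retN r ts; exact: congr1 (pend_other nc' nr').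
  case e: (pend w s i) tr mr => [|j u] tr mr.
  + exists None; split=> //; last by right; rewrite /= nc r e.
    rewrite inE co /=; apply/existsP; exists s; rewrite r /ret_ok /=.
    apply/andP; split; first by apply/negP => /hmt/mr.
    apply/eqP; rewrite tr; apply/ffunP => t; rewrite !ffunE.
    by case: eqP => // ->; rewrite e.
  + exists (Some (l j, claim u)); split=> //; last by left; rewrite /= nc r e.
    have n : nesting w s (j, i) by apply/nestingP; split=> //; exists u.
    rewrite inE co /=; apply/existsP; exists s; rewrite r /ret_ok /= tr eqxx andbT.
    have [mj mi] := nesting_matched n.
    apply/and3P; split; [exact/hmt|exact/hmt|apply: hm; apply/mu_ofP; by exists s].
- have c : is_internal (w i) by rewrite /is_internal k.
  split; last by move=> t; have [nc nr] := intN t c; exact: congr1 (pend_other nc nr).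
  rewrite inE co c /int_ok /= tops_int // eqxx andbT.
  by apply/negP => /hmt/matched_kind.
Qed.

Lemma seen_step i : seen i.+1 =
  if seen i == [set: _] then hits (l i) (tops i.+1) else seen i :|: hits (l i) (tops i.+1).
Proof. by []. Qed.

Lemma tiling_accepted : word_lang tiling_vpa w.
Proof.
have [h0 hl hm hmt hacc] := til; exists trun.
  split=> [i s||s|]; [exact: enc_rcons| |by []|exact: trun_step].
  by rewrite inE /=; apply/eqP; congr (_, _, _); apply/ffunP => s; rewrite !ffunE.
have full : infinitely_often (fun i => seen i = [set: _]).
  apply/(seen_full_often seen_step) => -[j|s] n.
    by have [m nm am] := hacc j n; exists m => //; rewrite inE.
  (* The hit at step [m] concerns the stack after this step, hence [n.+1]. *)
  have [[//|m] nm am] := @unmatched_top_often _ w s n.+1; exists m => //.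
  rewrite inE ffunE; case e: (pend w s m.+1) => [//|k u] /=.
  by apply/negP => /hmt; apply: am e.
have [q qio] := @infinitely_often_pigeonhole tstate (fun i => cstate (trun i)) _ full.
exists q; last first.
  by apply/infinite_setP => n; have [m nm [_ em]] := qio n; exists m.
by have [m _ [fm <-]] := qio 0; rewrite inE /= fm.
Qed.
End Encode.

Section Decode.
Variables (w : word S) (rho : nat -> config tiling_vpa).
Hypothesis run : is_run w rho.

Lemma core_label q a q' : core q a q' -> exists l, q'.1.1 = Some l.
Proof. by rewrite /core; case: q'.1.1 => // l _; exists l. Qed.

Lemma run_core i : core (cstate (rho i)) (w i) (cstate (rho i.+1)).
Proof.
have [_ _ _ /(_ i)] := run; rewrite /step; case: kind_of => [s|s|].
- by case=> X []; rewrite inE => /andP[].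
- by case=> X []; rewrite inE => /andP[].
- by case; rewrite inE => /andP[].
Qed.

Variable l : nat -> Lab.
Hypothesis lE : forall i, (cstate (rho i.+1)).1.1 = Some (l i).

Lemma run_inv i : (cstate (rho i)).1.2 = tops w l i /\
  forall s, cstack (rho i) s = enc l (pend w s i).
Proof.
have [_ h0 s0 st] := run.
elim: i => [|i [IHt IHs]].
  split=> [|s]; last exact: s0.
  move: h0; rewrite inE => /eqP->; apply/ffunP => s; by rewrite !ffunE.
have := st i; rewrite /step; case k: (kind_of (w i)) => [s|s|].
- have c : is_call s (w i) by rewrite /is_call k eqxx.
  case=> X [/(tcall_ok c) ok es eo]; move: ok; rewrite /call_ok lE.
  case: X es => [[l0 b]|//] es /and4P[/eqP e1 /eqP e2 _ /eqP e3].
  split; first by rewrite e3 IHt (tops_call l c).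
  move=> t; have [->|ts] := eqVneq t s.
    by rewrite es e1 e2 IHt IHs pend_call // ffunE.
  by rewrite eo // IHs; have [nc nr] := callN c ts; rewrite pend_other.
- have r : is_ret s (w i) by rewrite /is_ret k eqxx.
  case=> X [/(tret_ok r) ok es eo]; move: ok; rewrite /ret_ok lE.
  have other t : t != s -> cstack (rho i.+1) t = enc l (pend w t i.+1).
    by move=> ts; rewrite eo // IHs; have [nc nr] := retN r ts; rewrite pend_other.
  have tr := tops_ret l r; rewrite IHs in es.
  case e: (pend w s i) es tr => [|j u] es tr.
    case: X es => [[l0 b]|] es; first by case: es => -[].
    move=> /andP[_ /eqP e2]; split.
      rewrite e2 IHt tr; apply/ffunP => t; rewrite !ffunE.
      by case: eqP => // ->; rewrite e.
    move=> t; have [->|ts] := eqVneq t s; last exact: other.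
    by case: es => [[]//|[_ _ ->]]; rewrite pend_ret // e.
  case: X es => [[l0 b]|] es; last by case: es => -[].
  case: es => [[_ [e1 e2 e3]]|[]//].
  move=> /and4P[_ _ _ /eqP e4]; split; first by rewrite e4 IHt tr -e2.
  move=> t; have [->|ts] := eqVneq t s; last exact: other.
  by rewrite -e3 pend_ret // e.
- have c : is_internal (w i) by rewrite /is_internal k.
  case; rewrite inE /int_ok lE => /and3P[_ _ /andP[_ /eqP e]] es; split.
    by rewrite e IHt tops_int.
  by move=> t; rewrite es IHs; have [nc nr] := intN t c; rewrite pend_other.
Qed.

Lemma run_nesting s i j : nesting w s (i, j) -> [/\ mt (l i), mt (l j) & mat (l i) (l j)].
Proof.
move=> /nestingP[rj [u e]].
have [_ _ _ /(_ j)] := run; rewrite /step.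
move: (rj); rewrite {1}/is_ret; case: kind_of => // s' /eqP->.
case=> X [/(tret_ok rj) + es _]; rewrite /ret_ok lE.
have [_ /(_ s)] := run_inv j; rewrite e => st; rewrite st in es.
case: X es => [[l0 b]|] es; last by case: es => -[].
by case: es => [[_ [-> _ _]]|[]//] /and4P[].
Qed.

Hypothesis acpt : accepting rho.

Lemma run_hits j : infinitely_often (fun i => j \in hits (l i) (tops w l i.+1)).
Proof.
have sS i : (cstate (rho i.+1)).2 = if (cstate (rho i)).2 == [set: _]
    then hits (l i) (tops w l i.+1) else (cstate (rho i)).2 :|: hits (l i) (tops w l i.+1).
  have := run_core i; rewrite /core lE => /and3P[_ _ /eqP->].
  by rewrite (run_inv i.+1).1.
move: j; apply/(seen_full_often sS) => n.
have [f fF /infinite_setP/(_ n)[m nm em]] := acpt; exists m => //.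
by rewrite em; apply/eqP; rewrite inE in fF.
Qed.

(** A call wrongly claimed matched would stay on its stack for ever and all calls above it would
    inherit the claim, so the condition [inr s] would not be met again. Returns and internal letters
    are checked when read. *)
Lemma run_unmatched i : mt (l i) -> matched w i.
Proof.
move=> mi; have [_ _ _ /(_ i)] := run; rewrite /step; case k: (kind_of (w i)) => [s|s|].
- move=> _; have c : is_call s (w i) by rewrite /is_call k eqxx.
  apply: contrapT => um.
  have iin m : i < m -> i \in pend w s m.
    move=> im; have iS : i \in pend w s i.+1 by rewrite pend_call // mem_head.
    apply: contrapT => /negP /(pend_dropped iS im)[j nj].
    by have [/um] := nesting_matched nj.
  have above m : i < m -> exists u v, pend w s m = u ++ i :: v /\ {in u, forall k, mt (l k)}.
    elim: m => [//|m IH]; rewrite ltnS leq_eqVlt => /orP[/eqP<-|im].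
      by exists [::], (pend w s i); rewrite pend_call.
    have [u [v [e mu]]] := IH im.
    have [cm|ncm] := boolP (is_call s (w m)).
      exists (m :: u), v; rewrite pend_call // e; split=> // k'; rewrite inE.
      move=> /orP[/eqP->|/mu//].
      have tm : tops w l m s.
        by rewrite ffunE e; case: (u) mu => [//|k0 u0] mu; apply: mu; rewrite mem_head.
      have [_ _ _ /(_ m)] := run; rewrite /step; move: (cm).
      rewrite {1}/is_call; case: kind_of => // s' /eqP-> [X [/(tcall_ok cm) + _ _]].
      rewrite /call_ok lE; case: X => [[l0 b]|//].
      by rewrite (run_inv m).1 tm => /and4P[_ /eqP-> /= ].
    have [rm|nrm] := boolP (is_ret s (w m)); last by exists u, v; rewrite pend_other.
    have := iin m.+1 (leqW im); rewrite pend_ret // e.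
    case: u mu e => [|k0 u] mu e /=.
      by have := pend_notin_tail e => /negP.
    move=> _; exists u, v; split=> // k' ku; apply: mu; by rewrite inE ku orbT.
  have [m im] := run_hits (inr s) i; rewrite inE ffunE.
  have [u [v [-> mu]]] := above m.+1 im.
  by case: u mu => [|k' u] mu /=; rewrite ?mi ?mu ?mem_head.
- have r : is_ret s (w i) by rewrite /is_ret k eqxx.
  case=> X [/(tret_ok r) ok es _]; apply/(matched_ret r) => e.
  move: ok; rewrite /ret_ok lE.
  have [_ /(_ s)] := run_inv i; rewrite e => st; rewrite st in es.
  case: X es => [[l0 b]|] es; first by case: es => -[].
  by rewrite mi.
- by case; rewrite inE /int_ok lE mi => /and3P[].
Qed.

Lemma run_tiling : tiling w l.
Proof.
split.
- have := run_core 0; rewrite /core lE; have [_ h0 _ _] := run.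
  by move: h0; rewrite inE => /eqP-> /and3P[].
- move=> i; have := run_core i.+1; have := run_core i; rewrite /core !lE.
  by move=> /and3P[-> _ _] /and3P[_ -> _].
- by move=> i j /mu_ofP[s /run_nesting[]].
- move=> i; split; first exact: run_unmatched.
  by move=> [j [/mu_ofP[s /run_nesting[]]|/mu_ofP[s /run_nesting[]]]].
- by move=> j n; have [m nm am] := run_hits (inl j) n; exists m => //; rewrite inE in am.
Qed.
End Decode.

Theorem tiling_vpaP (w : word S) :
  word_lang tiling_vpa w <-> exists l, tiling w l.
Proof.
split=> [[rho run acpt]|[l]]; last exact: tiling_accepted.
have /choice[l lE] i : exists l, (cstate (rho i.+1)).1.1 = Some l.
  exact: core_label (run_core run i).
by exists l; apply: run_tiling lE acpt.
Qed.
End Tilings.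

(** * Counting and local views *)

Section Profiles.
Variables (J : finType) (t : nat).
Implicit Types (Q : J -> pred nat) (f : {ffun J -> option 'I_t.+1}).

(* [None]: infinitely many positions; [Some k]: finitely many, and [k] of them
   when counting up to the threshold [t]. *)
Definition profile Q f : Prop := forall j,
  match f j with
  | None => infinitely_often (fun i => Q j i)
  | Some k => exists m, (forall i, m <= i -> ~~ Q j i)
                /\ k = minn t (count (Q j) (iota 0 m)) :> nat
  end.

Lemma profile_exists Q : exists f, profile Q f.
Proof.
have /choice[f fP] (j : J) : exists o : option 'I_t.+1,
    match o with
    | None => infinitely_often (fun i => Q j i)
    | Some k => exists m, (forall i, m <= i -> ~~ Q j i)
                  /\ k = minn t (count (Q j) (iota 0 m)) :> nat
    end.
  have [io|nio] := pselect (infinitely_often (fun i => Q j i)); first by exists None.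
  have [m mP] : exists m, forall i, m <= i -> ~~ Q j i.
    apply: contrapT => nm; apply: nio => n; apply: contrapT => ni; apply: nm.
    by exists n => i le; apply/negP => Qi; apply: ni; exists i.
  exists (Some (inord (minn t (count (Q j) (iota 0 m))))), m; split=> //.
  by rewrite inordK // ltnS geq_minl.
by exists (finfun f) => j; rewrite ffunE; apply: fP.
Qed.

Lemma at_least_infinite (P : pred nat) n : infinitely_often (fun i => P i) -> at_least P n.
Proof.
move=> io; elim: n => [|n [s [us ss sP]]]; first by exists [::].
have [m _ [Pm ms]] := infinitely_often_notin s io 0.
by exists (m :: s); rewrite /= ms us ss Pm sP.
Qed.

Lemma profile_simulation Q Q' f j : profile Q f -> profile Q' f ->
  (forall n, n <= t -> at_least (Q j) n -> at_least (Q' j) n)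
  /\ (infinitely_often (fun i => Q j i) -> infinitely_often (fun i => Q' j i)).
Proof.
move=> /(_ j) + /(_ j); case: (f j) => [k|] q q'; last first.
  by split=> // n _ _; apply: at_least_infinite.
have [m [mP km]] := q; have [m' [mP' km']] := q'; split; last first.
  by move=> /(_ m)[i mi Qi]; have := mP i mi; rewrite Qi.
move=> n nt [s [us ss sP]].
have nc : n <= count (Q j) (iota 0 m).
  rewrite -ss -size_filter; apply: uniq_leq_size => // i si.
  have Qi := allP sP i si; rewrite mem_filter Qi mem_iota /= add0n ltnNge.
  by apply/negP => /mP; rewrite Qi.
have nc' : n <= count (Q' j) (iota 0 m').
  have : n <= minn t (count (Q' j) (iota 0 m')) by rewrite -km' km leq_min nt.
  by rewrite leq_min => /andP[].
exists (take n (filter (Q' j) (iota 0 m'))); split.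
- by apply/take_uniq/filter_uniq/iota_uniq.
- by rewrite size_takel // size_filter.
- by apply/allP => i /mem_take; rewrite mem_filter => /andP[].
Qed.
End Profiles.

(** * Tilings with a prescribed profile *)

Section Counting.
Variables (S : alphabet) (Lab J : finType) (t : nat).
Variables (init : pred Lab) (loc : rel Lab) (lett : S -> pred Lab)
  (mat : rel Lab) (mt : pred Lab) (Q : J -> pred Lab).
Variable good : pred {ffun J -> option 'I_t.+1}.

(* A label, the guessed profile, the numbers of earlier occurrences, and the
   guesses that a predicate does not hold from here on. *)
Definition counted : finType :=
  (Lab * {ffun J -> option 'I_t.+1} * {ffun J -> 'I_t.+1} * {ffun J -> bool})%type.

Definition cinit (x : counted) : bool :=
  [&& init x.1.1.1, good x.1.1.2 & [forall j, x.1.2 j == ord0]].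

Definition cloc (x y : counted) : bool :=
  [&& loc x.1.1.1 y.1.1.1, x.1.1.2 == y.1.1.2,
      [forall j, y.1.2 j == minn t (x.1.2 j + Q j x.1.1.1) :> nat]
    & [forall j, x.2 j ==> ~~ Q j x.1.1.1 && y.2 j]].

Definition cacc (j : J) (x : counted) : bool :=
  if x.1.1.2 j is Some k then x.2 j && (x.1.2 j == k) else Q j x.1.1.1.

Definition counted_tiling := tiling cinit cloc (fun a x => lett a x.1.1.1)
  (fun x y => mat x.1.1.1 y.1.1.1) (fun x => mt x.1.1.1) cacc.

Definition plain_tiling := tiling init loc lett mat mt (fun (_ : void) _ => true).

(** A raised flag persists and excludes further occurrences, so the counter is final from there on.
    Hence the acceptance conditions [cacc] verify the guessed profile, which [cloc] keeps
    constant. *)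
Lemma counted_tilingP (w : word S) :
  (exists x, counted_tiling w x) <->
  (exists l f, [/\ plain_tiling w l, good f & profile (fun j i => Q j (l i)) f]).
Proof.
have minDn c q : minn t (minn t c + q) = minn t (c + q) by lia.
split=> [[x [h0 hl hm hmt ha]]|[l [f [[h0 hl hm hmt _] gf pf]]]].
  pose l i := (x i).1.1.1; exists l, (x 0).1.1.2.
  have fE i : (x i).1.1.2 = (x 0).1.1.2.
    by elim: i => // i <-; have [/and4P[_ /eqP-> _ _] _] := hl i.
  have [i0 g0 c0] := and3P h0; split=> //.
    split=> //.
    by move=> i; have [/and4P[? _ _ _] ?] := hl i.
  have cE i j : (x i).1.2 j = minn t (count (fun i => Q j (l i)) (iota 0 i)) :> nat.
    elim: i => [|i IH]; first by rewrite (eqP (forallP c0 j)) /= minn0.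
    have [/and4P[_ _ /forallP/(_ j)/eqP-> _] _] := hl i.
    by rewrite IH -[i.+1]addn1 iotaD count_cat /= add0n addn0 minDn.
  have doneP i j : (x i).2 j -> ~~ Q j (l i) /\ (x i.+1).2 j.
    move=> dj; have [cl _] := hl i; case/and4P: cl => _ _ _ /forallP h.
    by have := h j; rewrite dj => /andP.
  move=> j; have := ha j; rewrite /cacc; case e: ((x 0).1.1.2 j) => [k|] io.
    have [m _] := io 0; rewrite fE e => /andP[dm /eqP cm]; exists m; split; last by rewrite -cE cm.
    have dd d : (x (m + d)).2 j.
      elim: d => [|d IH]; first by rewrite addn0.
      by have [_] := doneP (m + d) j IH; rewrite addnS.
    move=> i /subnKC <-; by have [] := doneP (m + (i - m)) j (dd _).
  by move=> n; have [m nm] := io n; rewrite fE e => qm; exists m.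
pose c i : {ffun J -> 'I_t.+1} :=
  [ffun j => inord (minn t (count (fun i => Q j (l i)) (iota 0 i)))].
have cE i j : c i j = minn t (count (fun i => Q j (l i)) (iota 0 i)) :> nat.
  by rewrite ffunE inordK // ltnS geq_minl.
pose d i : {ffun J -> bool} := [ffun j => `[< forall i', i <= i' -> ~~ Q j (l i') >]].
exists (fun i => (l i, f, c i, d i)); split=> //.
- apply/and3P; split=> //; apply/forallP => j; apply/eqP/val_inj.
  by rewrite /= cE minn0.
- move=> i; have [li le] := hl i; split=> //; apply/and4P; split=> //=.
  + apply/forallP => j; rewrite !cE -[i.+1]addn1 iotaD count_cat /= add0n addn0.
    by rewrite minDn.
  + apply/forallP => j; rewrite !ffunE; apply/implyP => /asboolP h.
    rewrite h //=; apply/asboolP => i' le'; apply: h; exact: ltnW.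
- move=> j; have := pf j; rewrite /cacc /=; case: (f j) => [k|//] [m [mP km]] n.
  exists (maxn n m); first by rewrite leq_maxl.
  apply/andP; split.
    by rewrite ffunE; apply/asboolP => i' le'; apply: mP; apply: leq_trans le'; rewrite leq_maxr.
  apply/eqP/val_inj; rewrite /= cE km; congr minn.
  rewrite -(subnKC (leq_maxr n m)) iotaD count_cat add0n -[RHS]addn0; congr addn.
  apply/eqP; rewrite -leqn0 leqNgt -has_count; apply/hasPn => i.
  by rewrite mem_iota => /andP[mi _]; apply: mP.
Qed.
End Counting.

(** * Tilings that certify ball types *)

Section Views.
Variables (S : alphabet) (Bv K R : nat).
(** The ends of two walks of length at most [R] are joined by a walk of length at most [R + R]; the
    successor makes [L] positive, so that neighbours get different colours. [N] leaves room for the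
    composed walks in [consistent]. *)
Let L := (R + R).+1.
Let N := L + L.

(* Letter, set variables, parity of the position, and colour. *)
Definition info : finType := (S * {ffun 'I_Bv.+1 -> bool} * bool * 'I_K.+1)%type.

Definition isym (c : info) : S := c.1.1.1.
Definition ipar (c : info) : bool := c.1.2.
Definition icol (c : info) : 'I_K.+1 := c.2.
Definition ibit (X : nat) (c : info) : bool := c.1.1.2 (inord X).

(* The information that a position claims to find at the end of each walk of
   length at most [N]. *)
Definition sight : finType := {ffun N.-bseq (option bool) -> info}.

Definition look (F : sight) (u : seq (option bool)) : info := F (insub_bseq N u).

Definition small (n : nat) (P : seq (option bool) -> bool) : bool :=
  [forall u : n.-bseq (option bool), P u].

Lemma smallP n (P : seq (option bool) -> bool) : reflect (forall u, size u <= n -> P u) (small n P).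
Proof.
apply: (iffP forallP) => [h u un|h u]; first exact: (h (Bseq un)).
exact: h (size_bseq u).
Qed.

Definition shift (g : option bool) (F F' : sight) : bool :=
  small N.-1 (fun u => look F (g :: u) == look F' u).

Definition consistent (F : sight) : bool :=
  small L (fun u => small L (fun h =>
    (icol (look F u) == icol (look F [::])) ==> (look F (u ++ h) == look F h)))
  && small L (fun u => simple_view icol (look F) u ==>
    (view_turning isym ipar (look F) u \in [:: 2; -2]%R)).

Definition sight_label : finType := (sight * bool)%type.

Definition far_colours (F F' : sight) : bool := icol (look F [::]) != icol (look F' [::]).

(** At position 0 the involution [Some true] is the identity, so the sight must be its own shift;
    [sight_lett] demands the same of [None] at unmatched positions. *)
Definition sight_init (x : sight_label) : bool :=
  ~~ ipar (look x.1 [::]) && shift (Some true) x.1 x.1.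

Definition sight_loc (x y : sight_label) : bool :=
  let g := Some (ipar (look x.1 [::])) in
  [&& ipar (look y.1 [::]) == ~~ ipar (look x.1 [::]), shift g x.1 y.1, shift g y.1 x.1
    & far_colours x.1 y.1].

Definition sight_lett (a : S) (x : sight_label) : bool :=
  [&& isym (look x.1 [::]) == a, x.2 || shift None x.1 x.1 & consistent x.1].

Definition sight_mat (x y : sight_label) : bool :=
  [&& shift None x.1 y.1, shift None y.1 x.1 & far_colours x.1 y.1].

Definition sight_matched (x : sight_label) : bool := x.2.

Definition sight_tiling := plain_tiling sight_init sight_loc sight_lett sight_mat sight_matched.

Definition ball_of (r : nat) (F : sight) : ball info r :=
  ([ffun u : r.-bseq _ => look F u],
   [ffun uv : r.-bseq _ * r.-bseq _ => icol (look F uv.1) == icol (look F uv.2)]).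

Section Sound.
Variables (w : word S) (x : nat -> sight_label).
Hypothesis til : sight_tiling w x.

Let F i := (x i).1.
Let lab i := look (F i) [::].

Lemma lab_sym i : isym (lab i) = w i.
Proof. by have [_ hl _ _ _] := til; have [_ /and3P[/eqP]] := hl i. Qed.

Lemma lab_par i : ipar (lab i) = odd i.
Proof.
have [/andP[/negbTE h0 _] hl _ _ _] := til.
elim: i => [//|i IH]; have [/and4P[/eqP + _ _ _] _] := hl i.
by rewrite -/(F i) -/(F i.+1) -/(lab i) IH => ->.
Qed.

Lemma shiftE g G G' u : shift g G G' -> size u < N -> look G (g :: u) = look G' u.
Proof. by move=> /smallP h lt; apply/eqP/h; rewrite -ltnS prednK //. Qed.

Lemma sight_shift g i : shift g (F i) (F (act w g i)).
Proof.
have [/andP[_ h0] hl hm hmt _] := til; case: g => [b|].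
  rewrite /act; case: eqP => [<-|/eqP nb].
    by have [/and4P[_ + _ _] _] := hl i; rewrite -/(F i) -/(lab i) lab_par.
  case: i nb => [|i] nb /=; first by case: b nb.
  have [/and4P[_ _ + _] _] := hl i; rewrite -/(F i) -/(lab i) lab_par.
  by move: nb => /=; case: b; case: (odd i).
have [mi|ni] := pselect (matched w i).
  by have [/hm/and3P[]|/hm/and3P[]] := partner_linked mi.
rewrite /= partnerN //; have [_ /and3P[_ + _]] := hl i.
by case e: (x i).2 => //; case: ni; apply/hmt.
Qed.

(** Each step hands the claim over to the position reached, and at the end of the walk the empty
    walk reads the label itself. *)
Lemma sight_view i u : size u <= N -> look (F i) u = lab (actl w u i).
Proof.
elim: u i => [//|g u IH] i lt; rewrite (shiftE (sight_shift g i)) // IH //.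
exact: ltnW.
Qed.

Definition tiling_model : model isym ipar := Model lab_sym lab_par.

Lemma tiling_proper : proper_coloring icol w lab L.
Proof.
have [_ hl hm _ _] := til.
have LN u h : size u <= L -> size h <= L -> size (u ++ h) <= N.
  by move=> lu lh; rewrite size_cat leq_add.
have LN' u : size u <= L -> size u <= N by move=> lu; apply: leq_trans lu (leq_addr _ _).
have cons i := proj2 (hl i).
apply: (colouring_proper lab_sym lab_par).
- have far i j : far_colours (F i) (F j) -> icol (lab j) <> icol (lab i).
    by move=> /eqP/nesym.
  move=> i [b|].
    rewrite /act; case: ifP => _ ne.
      by apply: far; have [/and4P[_ _ _ ->]] := hl i.
    case: i ne => [//|i] _ /=; apply/nesym/far.
    by have [/and4P[_ _ _ ->]] := hl i.
  move=> /partner_neq/partner_linked[] /hm/and3P[_ _ h].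
    exact: far.
  exact/nesym/far.
- move=> i u h lu lh; rewrite /view -!sight_view //; try exact: LN; try exact: LN'.
  have /and3P[_ _ /andP[/smallP/(_ u lu)/smallP/(_ h lh) c _]] := cons i.
  by move=> /eqP e; apply/eqP; move/implyP: c; apply.
- move=> i u lu sv; have /and3P[_ _ /andP[_ /smallP/(_ u lu)/implyP]] := cons i.
  have vE v : size v <= L -> look (F i) v = view w lab i v.
    by move=> lv; rewrite sight_view // LN'.
  have tk s : size (take s u) <= L by rewrite size_take_min geq_min lu orbT.
  have -> : view_turning isym ipar (look (F i)) u = view_turning isym ipar (view w lab i) u.
    by apply: eq_bigr => s _; rewrite !vE.
  apply; move: sv; rewrite /simple_view !vE //; congr [&& _, _, _ & uniq _].
  by apply: eq_map => s; rewrite vE.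
Qed.

(** The reverse of one walk followed by the other joins the two ends within length [L], so by
    properness equal colours mean equal positions. *)
Lemma tiling_ball r i : r <= R -> ball_of r (F i) = ball_at r tiling_model i.
Proof.
move=> rR; have rN : r <= N by rewrite /N /L; lia.
have sz (u : r.-bseq (option bool)) : size u <= N by apply: leq_trans (size_bseq u) rN.
congr pair; apply/ffunP => u; rewrite !ffunE /=; first exact: sight_view.
rewrite !sight_view //; apply/eqP/eqP => [e|-> //].
have := @tiling_proper (actl w u.1 i) (rev u.1 ++ u.2).
rewrite actl_cat actl_revK => -> //.
rewrite size_cat size_rev; apply: leq_trans (leq_add (size_bseq _) (size_bseq _)) _.
by rewrite /L; lia.
Qed.
End Sound.

Section Complete.
Variables (M : model isym ipar).
Let w := mword M.
Hypothesis proper : proper_coloring icol w (mlab M) L.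

Definition model_sight (i : nat) : sight := [ffun u : N.-bseq _ => mlab M (actl w u i)].
Definition model_tiling (i : nat) : sight_label := (model_sight i, `[< matched w i >]).

Lemma look_model i u : size u <= N -> look (model_sight i) u = mlab M (actl w u i).
Proof. by move=> le; rewrite /look ffunE insubdK. Qed.

Lemma shift_model g i j : act w g i = j -> shift g (model_sight i) (model_sight j).
Proof.
move=> <-; apply/smallP => u le; have lt : size u < N by rewrite /N /L in le *; lia.
by rewrite !look_model //; apply: ltnW.
Qed.

Lemma model_far g i j : act w g i = j -> j <> i -> far_colours (model_sight i) (model_sight j).
Proof.
move=> e ne; rewrite /far_colours !look_model // eq_sym; apply/eqP.
by have := @proper_adjacent _ _ _ icol w (mlab M) L isT proper i g; rewrite e; apply.
Qed.

Lemma model_vtiling : sight_tiling w model_tiling.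
Proof.
have LN' u : size u <= L -> size u <= N by move=> lu; apply: leq_trans lu (leq_addr _ _).
split; rewrite /model_tiling.
- by rewrite /sight_init /= look_model // mpar; apply: shift_model.
- move=> i; split.
    have e1 : act w (Some (odd i)) i = i.+1 by rewrite /act eqxx.
    have e2 : act w (Some (odd i)) i.+1 = i by rewrite -e1 actK.
    apply/and4P; rewrite !look_model // !mpar eqxx; split=> //.
    - exact: shift_model.
    - exact: shift_model.
    - by apply: (model_far e1); lia.
  apply/and3P; rewrite /= look_model // msym eqxx; split=> //.
    case: asboolP => //= ni; apply: shift_model; exact: partnerN.
  apply/andP; split.
    apply/smallP => u lu; apply/smallP => h lh; apply/implyP.
    have szuh : size (u ++ h) <= N by rewrite size_cat leq_add.
    have [lu' lh'] := (LN' _ u lu, LN' _ h lh).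
    rewrite !look_model // => /eqP e; apply/eqP.
    exact: (proper_transported proper lu lh e).
  apply/smallP => u lu; apply/implyP => sv.
  have vE v : size v <= L -> look (model_sight i) v = view w (mlab M) i v.
    by move=> lv; rewrite look_model // LN'.
  have tk s : size (take s u) <= L by rewrite size_take_min geq_min lu orbT.
  have -> : view_turning isym ipar (look (model_sight i)) u
      = view_turning isym ipar (view w (mlab M) i) u.
    by apply: eq_bigr => s _; rewrite !vE.
  apply: (proper_cycles_turn (@msym _ _ _ _ M) (@mpar _ _ _ _ M) proper lu).
  move: sv; rewrite /simple_view !vE //; congr [&& _, _, _ & uniq _].
  by apply: eq_map => s; rewrite vE.
- move=> i j ij; have e1 : act w None i = j by apply: partnerE; left.
  have e2 : act w None j = i by rewrite -e1 actK.
  rewrite /sight_mat /=; apply/and3P; split; [exact: shift_model|exact: shift_model|].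
  by apply: (model_far e1); have := mu_lt ij; lia.
- by move=> i; rewrite /sight_matched /=; split=> /asboolP.
- by case.
Qed.
End Complete.

End Views.

(** * From formulas to automata *)

Section Prefix.
Variable S : alphabet.
Implicit Types (p : mso S) (v : nested_word S).

Definition exs (l : seq nat) p : mso S := foldr (@MEx2 S) p l.

Lemma emso_prefix p : is_emso p -> exists l q, p = exs l q /\ no_set_quantifier q.
Proof.
elim: p => [x a|x y|x y|x y|x X|p IH|p IHp q IHq|x p IH|x p IH|X p IH] nq;
  try by exists [::]; eexists; split; last exact: nq.
by have [l [q [-> nq']]] := IH nq; exists (X :: l), q.
Qed.

Lemma is_emso_exs l p : no_set_quantifier p -> is_emso (exs l p).
Proof. by move=> nq; elim: l => [|X l //]; case: p nq. Qed.

Lemma free1_exs l p : free1 (exs l p) = free1 p.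
Proof. by elim: l. Qed.

Lemma free2_exs l p : free2 (exs l p) = [seq X <- free2 p | X \notin l].
Proof.
elim: l => [|X l /= ->]; first by rewrite filter_predT.
by rewrite -filter_predI; apply: eq_filter => Y; rewrite /= inE negb_or.
Qed.

Lemma sat_exs v e E l p : sat v e E (exs l p) <->
  exists E', (forall X, X \notin l -> E' X = E X) /\ sat v e E' p.
Proof.
elim: l E => [|X l IH] E /=.
  split=> [h|[E' [h]]]; first by exists E.
  by have -> : E' = E by apply: funext => X; apply: h.
split=> [[I /IH[E' [h s]]]|[E' [h s]]].
  exists E'; split=> // Y; rewrite inE negb_or => /andP[/negbTE YX Yl].
  by rewrite h // /upd YX.
exists (E' X); apply/IH; exists E'; split=> // Y Yl; rewrite /upd; case: eqP => [-> //|/eqP YX].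
by rewrite h // inE negb_or YX.
Qed.

Lemma sat_ext p v e e' E E' :
  {in free1 p, e =1 e'} -> {in free2 p, E =1 E'} -> sat v e E p <-> sat v e' E' p.
Proof.
have upd_ext (T : Type) (x : nat) (s : seq nat) (f f' : nat -> T) c :
    {in [seq y <- s | y != x], f =1 f'} -> {in s, upd f x c =1 upd f' x c}.
  move=> h y ys; rewrite /upd; case: eqP => // /eqP yx.
  by apply: h; rewrite mem_filter yx.
elim: p e e' E E' => [x a|x y|x y|x y|x X|p IH|p IHp q IHq|x p IH|x p IH|X p IH] e e' E E' /= h1 h2.
- by rewrite h1 ?mem_head.
- by rewrite !h1 ?inE ?eqxx ?orbT.
- by rewrite !h1 ?inE ?eqxx ?orbT.
- by rewrite !h1 ?inE ?eqxx ?orbT.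
- by rewrite h1 ?mem_head // h2 ?mem_head.
- by have := IH _ _ _ _ h1 h2; tauto.
- have := IHp e e' E E'; have := IHq e e' E E' => hq hp.
  rewrite hp ?hq // => x xp; [apply: h1|apply: h2|apply: h1|apply: h2];
    by rewrite mem_cat xp ?orbT.
- by split=> -[i si]; exists i; apply: (IH _ _ _ _ _ _).1 si => //; try exact: upd_ext;
    [move=> y yp; rewrite (upd_ext _ _ _ _ _ _ h1)|move=> y yp; rewrite h2].
- have e1 i : sat v (upd e x i) E p <-> sat v (upd e' x i) E' p by apply: IH => //; apply: upd_ext.
  by split=> /infinite_setP h; apply/infinite_setP => n; have [m nm /e1 sm] := h n; exists m.
- by split=> -[I sI]; exists I; move: sI; apply IH => // Y Yp;
    rewrite ?h1 // (upd_ext _ _ _ _ _ _ h2).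
Qed.

Lemma mso_lang_exs l p v : sentence (exs l p) ->
  mso_lang (exs l p) v <-> exists E, sat v (fun _ => 0) E p.
Proof.
rewrite /sentence free1_exs free2_exs => /andP[/eqP f1 /eqP f2].
have f2l X : X \in free2 p -> X \in l.
  move=> Xp; apply: contraT => Xl.
  have : X \in [seq X <- free2 p | X \notin l] by rewrite mem_filter Xl.
  by rewrite f2.
split=> [/(_ (fun _ => 0) (fun _ => set0)) /sat_exs[E [_ h]]|[E h] e E0].
  by exists E.
apply/sat_exs; exists (fun X => if X \in l then E X else E0 X); split.
  by move=> X /negbTE->.
apply/(sat_ext _ _ _).1: h => [x|X /f2l ->//]; by rewrite f1.
Qed.
End Prefix.

Section EmsoToVpa.
Variables (S : alphabet) (p : mso S).
Hypothesis nsq : no_set_quantifier p.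
Hypothesis closed1 : free1 p = [::].

Let Bv := \max_(X <- free2 p) X.

Lemma vpa_of_kernel : exists A : vpa S, forall w,
  word_lang A w <-> exists E, sat (nested w) (fun _ => 0) E p.
Proof.
have [|R [t loc]] := msat_local nsq (V := [::]); first by rewrite closed1.
pose e0 (_ : nat) := 0; pose L := (R + R).+1; pose K := size (words L).
pose mdl := model (@isym S Bv K) (@ipar S Bv K).
pose J : finType := {r : 'I_R.+1 & ball (info S Bv K) r}.
pose QM (M : mdl) (j : J) : pred nat := fun i => ball_at (tag j) M i == tagged j.
pose Q (j : J) : pred (sight_label S Bv K R) := fun x => ball_of (tag j) x.1 == tagged j.
(* The profiles of models of [p]. By locality every model with such a profile satisfies [p], so it
   is enough that the automaton guesses one of them. *)
pose good (f : {ffun J -> option 'I_t.+1}) : bool :=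
  `[< exists2 M : mdl, profile (QM M) f & msat (@ibit S Bv K) M e0 p >].
have sim (M M' : mdl) (f : {ffun J -> option 'I_t.+1}) :
    profile (QM M) f -> profile (QM M') f -> ball_simulated R t M M'.
  move=> pM pM' r b rR; have lt : r < R.+1 by [].
  pose j : J := Tagged (fun r : 'I_R.+1 => ball (info S Bv K) r) (b : ball _ (Ordinal lt)).
  have [h1 h2] := profile_simulation j pM pM'.
  split; first exact: h1.
  move=> io n; have [|m nm /eqP Qm] := h2 _ n; last by exists m.
  by move=> k; have [m km /eqP Qm] := io k; exists m.
have QE w x (til : sight_tiling w x) : (fun j i => Q j (x i)) = QM (tiling_model til).
  apply: funext => j; apply: funext => i; rewrite /Q /QM.
  by have -> : ball_of (tag j) (x i).1 = ball_at (tag j) (tiling_model til) i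
    by apply: tiling_ball; rewrite -ltnS.
exists (tiling_vpa (cinit (@sight_init S Bv K R) good) (cloc (t := t) (@sight_loc S Bv K R) Q)
  (fun a x => sight_lett a x.1.1.1) (fun x y => sight_mat x.1.1.1 y.1.1.1)
  (fun x => sight_matched x.1.1.1) (cacc Q)) => w.
rewrite tiling_vpaP; split.
  move=> /counted_tilingP[x [f [til /asboolP[M0 pM0 sM0] px]]].
  rewrite (QE w x til) in px.
  eexists; apply: (loc _ _ _ (@ibit S Bv K) M0 (tiling_model til) e0 e0 _ _ _ sM0).
  - exact: sim pM0 px.
  - exact: sim px pM0.
  - by split.
(* Conversely, a proper colouring and the values of [E] label the positions; the resulting tiling is
   itself a model that makes its profile good. *)
move=> [E sE]; apply/counted_tilingP.
have [c cP] := proper_colouring_exists w L.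
pose lab (x : nat) : info S Bv K := (w x, [ffun X : 'I_Bv.+1 => `[< E X x >]], odd x, c x).
have lsym x : isym (lab x) = w x by [].
have lpar x : ipar (lab x) = odd x by [].
pose M : mdl := Model lsym lpar.
have prop : proper_coloring (@icol S Bv K) w (mlab M) L by move=> x u; exact: cP.
have til := model_vtiling prop.
have [f pf] := profile_exists t (fun j i => Q j (model_tiling R M i)).
exists (model_tiling R M), f; split=> //.
apply/asboolP; exists (tiling_model til); first by rewrite -QE.
apply/(sat_ext _ _ _).1: sE => [//|X Xp].
have bitE x : ibit X (mlab (tiling_model til) x) = `[< E X x >].
  rewrite /= look_model // /ibit /= ffunE inordK // ltnS.
  exact: (@leq_bigmax_seq _ _ predT id).
by apply/seteqP; split=> x /=; rewrite bitE; [move=> Ex; apply/asboolP|move/asboolP].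
Qed.
End EmsoToVpa.

Lemma vpa_langE (S : alphabet) (A : vpa S) v : vpa_lang A v <-> word_lang A (label v).
Proof.
split=> [[w Aw <-]//|Av]; exists (label v) => //; exact: nested_label.
Qed.

Lemma emso_vpa (S : alphabet) (phi : mso S) : sentence phi -> is_emso phi ->
  exists A : vpa S, vpa_lang A = mso_lang phi.
Proof.
move=> sp /emso_prefix[l [q [e nq]]]; rewrite e in sp *.
have cl : free1 q = [::] by move: sp; rewrite /sentence free1_exs => /andP[/eqP].
have [A AP] := vpa_of_kernel nq cl; exists A; apply/seteqP.
by split=> v; [move=> /vpa_langE|move=> h; apply/vpa_langE; move: h];
  [move=> /AP h; apply/mso_lang_exs|move=> /(mso_lang_exs _ sp) h; apply/AP];
  rewrite ?nested_label // in h *.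
Qed.

(** * From automata to formulas *)

Section Formulas.
Variable S : alphabet.
Implicit Types (p q : mso S) (v : nested_word S).

Definition mand p q : mso S := MNot (MOr (MNot p) (MNot q)).
Definition mimp p q : mso S := MOr (MNot p) q.
Definition mall x p : mso S := MNot (MEx x (MNot p)).
Definition mfalse x : mso S := MNot (MEq S x x).
Definition mbig x (s : seq (mso S)) : mso S := foldr (@MOr S) (mfalse x) s.

Lemma sat_mand v e E p q : sat v e E (mand p q) <-> sat v e E p /\ sat v e E q.
Proof. by rewrite /= not_orE !notK. Qed.

Lemma sat_mimp v e E p q : sat v e E (mimp p q) <-> (sat v e E p -> sat v e E q).
Proof.
split=> [[]//|h]; have [sp|np] := pselect (sat v e E p); [right; exact: h|by left].
Qed.

Lemma sat_mall v e E x p : sat v e E (mall x p) <-> forall i, sat v (upd e x i) E p.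
Proof.
split=> [h i|h [i ni]]; last exact: ni (h i).
by apply: contrapT => ni; apply: h; exists i.
Qed.

Lemma sat_mbig (I : eqType) v e E x (F : I -> mso S) (s : seq I) :
  sat v e E (mbig x (map F s)) <-> exists2 i, i \in s & sat v e E (F i).
Proof.
elim: s => [|j s IH] /=; first by split=> [nx|[]//]; case: nx.
split=> [[h|/IH[i si h]]|[i]].
- by exists j; rewrite ?mem_head.
- by exists i; rewrite // inE si orbT.
- by rewrite inE => /orP[/eqP->|si] h; [left|right; apply/IH; exists i].
Qed.

Definition within (V : seq nat) (n : nat) p : bool :=
  [&& no_set_quantifier p, all (mem V) (free1 p) & all (gtn n) (free2 p)].

Lemma within_or V n p q : within V n p -> within V n q -> within V n (MOr p q).
Proof. by move=> /and3P[a b c] /and3P[a' b' c']; rewrite /within /= a a' !all_cat b b' c c'. Qed.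

Lemma within_not V n p : within V n (MNot p) = within V n p.
Proof. by []. Qed.

Lemma within_and V n p q : within V n p -> within V n q -> within V n (mand p q).
Proof. exact: within_or. Qed.

Lemma within_imp V n p q : within V n p -> within V n q -> within V n (mimp p q).
Proof. exact: within_or. Qed.

Lemma within_ex V n x p : within (x :: V) n p -> within V n (MEx x p).
Proof.
move=> /and3P[a b c]; apply/and3P; split=> //=.
apply/allP => y; rewrite mem_filter => /andP[yx /(allP b)].
by rewrite !inE (negPf yx).
Qed.

Lemma within_exinf V n x p : within (x :: V) n p -> within V n (MExInf x p).
Proof. exact: (@within_ex V n x p). Qed.

Lemma within_all V n x p : within (x :: V) n p -> within V n (mall x p).
Proof. exact: (@within_ex V n x (MNot p)). Qed.

Lemma within_big (I : eqType) V n x (F : I -> mso S) (s : seq I) : x \in V ->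
  (forall i, within V n (F i)) -> within V n (mbig x (map F s)).
Proof.
move=> xV h; elim: s => [|i s IH]; first by rewrite /within /= xV.
exact: within_or.
Qed.

Variable A : vpa S.

(* The label of a position is the transition read there: source, stack symbol
   (bottom for an internal letter) and target. *)
Definition trans : finType := (vstate A * vsym A * vstate A)%type.

Definition trans_ok (a : S) (r : trans) : bool :=
  match kind_of a with
  | Call _ => (r.1.1, a, r.1.2, r.2) \in vcall A
  | Ret _ => (r.1.1, a, r.1.2, r.2) \in vret A
  | Internal => (r.1.1, a, r.2) \in vint A
  end.

Definition is_return (a : S) : bool := [exists s, is_ret s a].

Record transition_run (w : word S) (l : nat -> trans) : Prop := TransitionRun {
  run_ok : forall i, trans_ok (w i) (l i);
  run_next : forall i, (l i).2 = (l i.+1).1.1;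
  run_init : (l 0).1.1 \in vinit A;
  run_mu : forall i j, mu_of w (i, j) -> (l i).1.2 = (l j).1.2;
  run_bot : forall i, ~ (exists j, mu_of w (j, i)) -> is_return (w i) -> (l i).1.2 = vbot A;
  run_final : exists2 f, f \in vfinal A & infinitely_often (fun i => (l i).2 = f)
}.

Lemma is_returnP s (a : S) : kind_of a = Ret s -> is_ret s a.
Proof. by rewrite /is_ret => ->. Qed.

Lemma is_callP s (a : S) : kind_of a = Call s -> is_call s a.
Proof. by rewrite /is_call => ->. Qed.

Lemma pend_matched (w : word S) s i k u : is_ret s (w i) -> pend w s i = k :: u -> mu_of w (k, i).
Proof.
by move=> r e; apply/mu_ofP; exists s; apply/nestingP; split=> //; exists u.
Qed.

Lemma pend_unmatched (w : word S) s i : is_ret s (w i) -> pend w s i = [::] ->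
  ~ exists j, mu_of w (j, i).
Proof.
move=> r e [j ji]; have /(matched_ret r) : matched w i by exists j; right.
by rewrite e.
Qed.

(** Each stack holds the symbols of the transitions read at its pending calls. So all pops are right
    iff matched positions carry the same symbol and unmatched returns carry bottom. *)
Lemma transition_runP (w : word S) :
  word_lang A w <-> exists l, transition_run w l.
Proof.
split=> [[rho [st r0 s0 stp] [f fF /infinite_setP fio]]|[l [ok nx i0 mu bot [f fF fio]]]].
  have /choice[X XP] i : exists X, let r := (cstate (rho i), X, cstate (rho i.+1)) in
      trans_ok (w i) r /\
      match kind_of (w i) with
      | Call s => cstack (rho i.+1) s = X :: cstack (rho i) s /\
           same_stacks_but s (rho i) (rho i.+1)
      | Ret s => ((X <> vbot A /\ cstack (rho i) s = X :: cstack (rho i.+1) s) \/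
          [/\ X = vbot A, cstack (rho i) s = [:: vbot A]
            & cstack (rho i.+1) s = [:: vbot A]]) /\
           same_stacks_but s (rho i) (rho i.+1)
      | Internal => forall t, cstack (rho i.+1) t = cstack (rho i) t
      end.
    have := stp i; rewrite /step /trans_ok; case: kind_of => [s|s|].
    - by case=> X [h1 h2 h3]; exists X.
    - by case=> X [h1 h2 h3]; exists X.
    - by case=> h1 h2; exists (vbot A).
  pose l i : trans := (cstate (rho i), X i, cstate (rho i.+1)).
  have stk i s : cstack (rho i) s = rcons (map X (pend w s i)) (vbot A).
    elim: i s => [|i IH] s; first exact: s0.
    have [ok] := XP i; case k: (kind_of (w i)) => [s'|s'|] h.
    - have c := is_callP k; have [->|ss] := eqVneq s s'.
        by rewrite h.1 IH pend_call.
      by have [nc nr] := callN c ss; rewrite h.2 // IH pend_other.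
    - have r := is_returnP k; have [->|ss] := eqVneq s s'; last first.
        by have [nc nr] := retN r ss; rewrite h.2 // IH pend_other.
      rewrite pend_ret //; case: h => h _; rewrite IH in h.
      case e: (pend w s' i) h => [|j u] [].
      + by case=> nb [eb _]; case: nb.
      + by case.
      + by case=> _ [_ <-].
      + by case=> _; case: (u).
    - by have [nc nr] : ~~ is_call s (w i) /\ ~~ is_ret s (w i);
        [rewrite /is_call /is_ret k|rewrite h IH pend_other].
  exists l; split=> //.
  - by move=> i; have [] := XP i.
  - move=> i j /mu_ofP[s /nestingP[r [u e]]]; have [_] := XP j.
    have := stk j s; rewrite e; move: r; rewrite /is_ret; case: kind_of => // s' /eqP->.
    move=> -> [[[_ [e1 _]]|[_ + _]] _]; first exact: e1.
    by case: (u).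
  - move=> i nm /existsP[s r]; have [_] := XP i; move: (r); rewrite {1}/is_ret.
    case: kind_of => // s' /eqP->; rewrite stk; case e: (pend w s i) => [|k u].
      by case=> [[[nb [eb _]]|[]//] _]; case: nb.
    by case: nm; exists k; apply: pend_matched r e.
  (* The state at [m.+1] is the target of transition [m], hence [n.+1]. *)
  - exists f => // n; have [[//|m] nm em] := fio n.+1; exists m => //.
pose stack i s := rcons (map (fun k => (l k).1.2) (pend w s i)) (vbot A).
exists (fun i => Config (l i).1.1 (stack i)); last first.
  exists f => //; apply/infinite_setP => n; have [m nm em] := fio n.
  by exists m.+1; [exact: leqW|rewrite /= -nx].
have nbot k s : is_call s (w k) -> (l k).1.2 != vbot A.
  move=> c; have := ok k; rewrite /trans_ok; move: c; rewrite /is_call.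
  by case: kind_of => // s' _ /vcall_sub/andP[].
split=> [i s||//|i].
- exists (map (fun k => (l k).1.2) (pend w s i)) => //.
  apply/negP => /mapP[k kp e].
  have ck : is_call s (w k).
    elim: (i) kp => [//|m IH] /=; case: ifP => cm.
      by rewrite inE => /orP[/eqP->|/IH].
    by case: ifP => _ // /mem_behead.
  by have := nbot _ _ ck; rewrite -e eqxx.
- exact: i0.
- have := ok i; rewrite /step /trans_ok; case k: (kind_of (w i)) => [s|s|] tr.
  + have c := is_callP k; exists (l i).1.2; split=> /=; first by rewrite -nx.
      by rewrite /stack pend_call.
    by move=> t ts; have [nc nr] := callN c ts; rewrite /= /stack pend_other.
  + have r := is_returnP k; exists (l i).1.2; split=> /=; first by rewrite -nx.
      rewrite /stack pend_ret //; case e: (pend w s i) => [|j u] /=.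
        right; split=> //; apply: bot; first exact: pend_unmatched r e.
        by apply/existsP; exists s.
      left; have ji := pend_matched r e; rewrite -(mu _ _ ji); split=> //.
      by apply/eqP; have [_ c _ _] := pend_head e; apply: nbot c.
    by move=> t ts; have [nc nr] := retN r ts; rewrite /= /stack pend_other.
  + split=> [|t]; first by rewrite -nx.
    rewrite /= /stack pend_other //.
      by rewrite /is_call k.
    by rewrite /is_ret k.
Qed.

Let code (r : trans) : nat := enum_rank r.
Let n := #|trans|.

Lemma code_lt r : code r < n. Proof. exact: ltn_ord. Qed.

Definition pairs x y (R : rel trans) : mso S :=
  mbig x [seq mand (MIn S x (code r.1)) (MIn S y (code r.2))
         | r <- enum {: trans * trans} & R r.1 r.2].

Definition letters x (R : S -> pred trans) : mso S :=
  mbig x [seq mand (MLabel x r.1) (MIn S x (code r.2))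
         | r <- enum {: S * trans} & R r.1 r.2].

Lemma sat_pairs v e E x y R : sat v e E (pairs x y R) <->
  exists r r', [/\ R r r', E (code r) (e x) & E (code r') (e y)].
Proof.
rewrite /pairs sat_mbig; split=> [[[r r']]|[r [r' [h1 h2 h3]]]].
  by rewrite mem_filter => /andP[h _] /sat_mand[h1 h2]; exists r, r'.
by exists (r, r'); [rewrite mem_filter mem_enum h1|apply/sat_mand].
Qed.

Lemma sat_letters v e E x R : sat v e E (letters x R) <->
  exists r, R (label v (e x)) r /\ E (code r) (e x).
Proof.
rewrite /letters sat_mbig; split=> [[[a r]]|[r [h1 h2]]].
  by rewrite mem_filter => /andP[h _] /sat_mand[/= -> h2]; exists r.
by exists (label v (e x), r); [rewrite mem_filter mem_enum h1|apply/sat_mand].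
Qed.

Lemma within_pairs V x y R : x \in V -> y \in V -> within V n (pairs x y R).
Proof.
move=> xV yV; apply: within_big => // r; apply: within_and;
  by rewrite /within /= ?xV ?yV code_lt.
Qed.

Lemma within_letters V x R : x \in V -> within V n (letters x R).
Proof.
move=> xV; apply: within_big => // r; apply: within_and;
  by rewrite /within /= ?xV ?code_lt.
Qed.

(** The set variable [code r] stands for the positions with transition [r]; the first two conditions
    give every position exactly one. The initial position is recognised by having no predecessor.
    The outer [MEx 0] at the end binds the variable of [mfalse] in [mbig]. *)
Definition run_conditions : seq (mso S) := [::
  mall 0 (letters 0 trans_ok);
  mall 0 (MNot (pairs 0 0 (fun r r' => r != r')));
  mall 0 (mall 1 (mimp (MSucc S 0 1) (pairs 0 1 (fun r r' => r.2 == r'.1.1))));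
  mall 0 (MOr (MEx 1 (MSucc S 1 0)) (pairs 0 0 (fun r _ => r.1.1 \in vinit A)));
  mall 0 (mall 1 (mimp (MMu S 0 1) (pairs 0 1 (fun r r' => r.1.2 == r'.1.2))));
  mall 0 (MOr (MEx 1 (MMu S 1 0))
              (letters 0 (fun a r => is_return a ==> (r.1.2 == vbot A))));
  MEx 0 (mbig 0 [seq MExInf 0 (pairs 0 0 (fun r _ => r.2 == f)) | f <- enum (vfinal A)])].

Definition run_formula : mso S := foldr mand (MNot (MEx 0 (mfalse 0))) run_conditions.

Lemma within_run_formula : within [::] n run_formula.
Proof.
rewrite /run_formula /=; do !apply: within_and => //.
- by apply/within_all/within_letters.
- by apply/within_all; rewrite within_not; apply: within_pairs.
- by do 2!apply/within_all; apply: within_imp => //; apply: within_pairs.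
- by apply/within_all/within_or; [|apply: within_pairs].
- by do 2!apply/within_all; apply: within_imp => //; apply: within_pairs.
- by apply/within_all/within_or; [|apply: within_letters].
- by apply/within_ex/within_big => // f; apply/within_exinf/within_pairs.
Qed.

Lemma sat_run_formula v : (exists E, sat v (fun _ => 0) E run_formula) <->
  exists l, transition_run (label v) l.
Proof.
have muE i j : mu v (i, j) = mu_of (label v) (i, j) by rewrite -{1}(nested_label v).
rewrite /run_formula [foldr _ _ _]/=.
split=> [[E]|[l [ok nx i0 mu bot [f fF fio]]]].
  move=> /sat_mand[/sat_mall c1 /sat_mand[/sat_mall c2 /sat_mand[/sat_mall c3
    /sat_mand[/sat_mall c4 /sat_mand[/sat_mall c5 /sat_mand[/sat_mall c6
    /sat_mand[c7 _]]]]]]].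
  have /choice[l lP] i : exists r, trans_ok (label v i) r /\ E (code r) i.
    exact: (sat_letters _ _ _ _ _).1 (c1 i).
  have uniq i r : E (code r) i -> r = l i.
    move=> Er; apply/eqP/negP => ne; apply: (c2 i).
    apply: (sat_pairs v (upd (fun=> 0) 0 i) E 0 0 (fun r r' => r != r')).2.
    by exists r, (l i); split=> //; [exact/negP|exact: (lP i).2].
  exists l; split.
  - by move=> i; have [] := lP i.
  - move=> i; have /sat_mimp/(_ erefl)/sat_pairs := (sat_mall _ _ _ _ _).1 (c3 i) i.+1.
    by case=> r [r' [/eqP h /uniq er /uniq er']]; move: h; rewrite er er'.
  - case: (c4 0) => [[i]//|/sat_pairs[r [r' [h /uniq er _]]]].
    by rewrite -[l 0]er.
  - move=> i j ij; have /sat_mimp := (sat_mall _ _ _ _ _).1 (c5 i) j.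
    rewrite /= muE => /(_ ij)/sat_pairs.
    by case=> r [r' [/eqP h /uniq er /uniq er']]; move: h; rewrite er er'.
  - move=> i nm ri; case: (c6 i) => [[j] /=|].
      by rewrite /= muE => ji; case: nm; exists j.
    move=> /sat_letters[r [/implyP h /uniq er]].
    by rewrite -er; apply/eqP/h.
  - case: c7 => i /sat_mbig[f]; rewrite mem_enum => fF /infinite_setP h.
    exists f => // m; have [k mk kp] := h m.
    have [r [r' [/eqP rf /uniq er _]]] := (sat_pairs _ _ _ _ _ _).1 kp.
    by exists k => //; rewrite -[l k]er.
pose E m : set nat := [set i | code (l i) = m]%classic.
have El i : E (code (l i)) i by [].
have uniq i r : E (code r) i -> r = l i.
  by move=> /= /ord_inj /enum_rank_inj.
have pr e x y (R : rel trans) : R (l (e x)) (l (e y)) -> sat v e E (pairs x y R).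
  by move=> h; apply/sat_pairs; exists (l (e x)), (l (e y)).
exists E; apply/sat_mand; split.
  by apply/sat_mall => i; apply/sat_letters; exists (l i).
apply/sat_mand; split.
  apply/sat_mall => i /sat_pairs[r [r' [ne /uniq er /uniq er']]].
  by rewrite er er' eqxx in ne.
apply/sat_mand; split.
  apply/sat_mall => i; apply/sat_mall => j; apply/sat_mimp => /= ij.
  by apply: pr; rewrite /upd /= in ij *; rewrite ij nx.
apply/sat_mand; split.
  apply/sat_mall => -[|i]; last by left; exists i.
  by right; apply: pr.
apply/sat_mand; split.
  apply/sat_mall => i; apply/sat_mall => j; apply/sat_mimp; rewrite /= muE => ij.
  by apply: pr; rewrite /upd /= in ij *; apply/eqP/mu.
apply/sat_mand; split.
  apply/sat_mall => i; have [[j ji]|nm] := pselect (exists j, mu_of (label v) (j, i)).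
    by left; exists j; rewrite /= muE.
  right; apply/sat_letters; exists (l i); split=> //.
  by apply/implyP => ri; apply/eqP/bot.
apply/sat_mand; split.
  exists 0; apply/sat_mbig; exists f; first by rewrite mem_enum.
  apply/infinite_setP => m; have [k mk ek] := fio m; exists k => //.
  by apply: (pr (upd (upd (fun=> 0) 0 0) 0 k) 0 0 (fun r _ => r.2 == f)); apply/eqP.
by case=> i; case.
Qed.
End Formulas.

Lemma vpa_emso (S : alphabet) (A : vpa S) :
  exists phi : mso S, [/\ sentence phi, is_emso phi & mso_lang phi = vpa_lang A].
Proof.
have /and3P[nq w1 w2] := within_run_formula A.
set n := #|_| in w2; set p := run_formula A in nq w1 w2.
have sp : sentence (exs (iota 0 n) p).
  rewrite /sentence free1_exs free2_exs; apply/andP; split.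
    by case: (free1 p) w1.
  rewrite -size_eq0 size_filter -leqn0 leqNgt -has_count; apply/hasPn => X.
  by move=> /(allP w2) Xn; rewrite mem_iota negbK.
exists (exs (iota 0 n) p); split=> //; first exact: is_emso_exs.
apply/seteqP; split=> v.
  by move=> /(mso_lang_exs _ sp)/sat_run_formula/transition_runP/vpa_langE.
by move=> /vpa_langE/transition_runP/sat_run_formula/(mso_lang_exs _ sp).
Qed.

Theorem theorem6p9 (S : alphabet) (L : set (nested_word S)) :
  (exists A : vpa S, vpa_lang A = L) <->
  (exists phi : mso S, [/\ sentence phi, is_emso phi & mso_lang phi = L]).
Proof.
split=> [[A <-]|[phi [sp ep <-]]]; first exact: vpa_emso.
exact: emso_vpa.
Qed.
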